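(* Let $k\geq 1$ be an integer. There exists a flag triangulation of the connected sum of $k$ tori $\#_k(\mathbb{S}^1\times\mathbb{S}^1)$ with at most $8+4k$ vertices, and there exists a flag triangulation of the connected sum of $k$ real projective planes $\#_k\mathbb{R}P^2$ with at most $8+3k$ vertices. Equivalently, a vertex-minimal flag triangulation of these surfaces has at most $8+4k$, resp. $8+3k$, vertices.
   Context: A simplicial complex is flag if all its minimal non-faces have cardinality 2. *)

(* Defs.v *)
From HB Require Import structures.
From Stdlib Require Import Relations.
From mathcomp Require Import all_boot all_order all_algebra generic_quotient.
From mathcomp Require Import all_classical all_reals all_analysis.

Set Implicit Arguments.
Unset Strict Implicit.
Unset Printing Implicit Defensive.

Import Order.TTheory GRing.Theory Num.Theory.
Import numFieldNormedType.Exports.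

Local Open Scope classical_set_scope.
Local Open Scope ring_scope.
Local Open Scope quotient_scope.

Definition homeomorphic (X Y : topologicalType) : Prop :=
  exists (f : X -> Y) (g : Y -> X),
    [/\ cancel f g, cancel g f, continuous f & continuous g].

Definition embedding (X Y : topologicalType) (f : X -> Y) : Prop :=
  [/\ injective f, continuous f
    & forall U : set X, open U -> exists2 V : set Y, open V & f @^-1` V = U].

(** The library norm on ['rV[R]_n] is the sup norm, hence the explicit
    Euclidean square norm. *)
Definition sqnorm (R : realType) (n : nat) (x : 'rV[R]_n) : R :=
  \sum_i x ord0 i ^+ 2.

Definition unit_ball (R : realType) (n : nat) : set 'rV[R]_n :=
  [set x | sqnorm x <= 1].

Definition unit_sphere (R : realType) (n : nat) : set 'rV[R]_n.+1 :=
  [set x | sqnorm x = 1].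

Definition disc (R : realType) : topologicalType :=
  set_type (@unit_ball R 2).

Definition sphere (R : realType) (n : nat) : topologicalType :=
  set_type (@unit_sphere R n).

Definition torus (R : realType) : topologicalType :=
  (sphere R 1 * sphere R 1)%type.

(** The 2-sphere modulo the antipodal map. *)
Section projective_plane.
Variable R : realType.

Definition antipodal (x y : sphere R 2) : bool :=
  (val x == val y) || (val x == - val y).

Lemma antipodal_refl : reflexive antipodal.
Proof. by move=> x; rewrite /antipodal eqxx. Qed.

Lemma antipodal_sym : symmetric antipodal.
Proof.
move=> x y; rewrite /antipodal eq_sym; congr (_ || _).
by rewrite -eqr_oppLR eq_sym.
Qed.

Lemma antipodal_trans : transitive antipodal.
Proof.
move=> y x z; rewrite /antipodal.
by case/orP=> /eqP -> /orP[]/eqP ->; rewrite ?opprK eqxx ?orbT.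
Qed.

Definition antipodal_equiv :=
  EquivRel antipodal antipodal_refl antipodal_sym antipodal_trans.

Definition projective_plane : topologicalType :=
  quotient_topology {eq_quot antipodal_equiv}.

End projective_plane.

Section connected_sum.
Variables (R : realType) (M N : topologicalType).
Variables (e1 : disc R -> M) (e2 : disc R -> N).

Definition open_disc : set (disc R) := [set x | sqnorm (val x) < 1].

Definition punctured_l : topologicalType := set_type (~` (e1 @` open_disc)).
Definition punctured_r : topologicalType := set_type (~` (e2 @` open_disc)).

Definition pieces (b : bool) : topologicalType :=
  if b then punctured_l else punctured_r.

Inductive glued : {b : bool & pieces b} -> {b : bool & pieces b} -> Prop :=
| Glued (x : disc R) (p : punctured_l) (q : punctured_r) :
    sqnorm (val x) = 1 -> set_val p = e1 x -> set_val q = e2 x ->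
    glued (existT pieces true p) (existT pieces false q).

Definition glue_rel (u v : {b : bool & pieces b}) : bool :=
  `[< clos_refl_sym_trans _ glued u v >].

Lemma glue_rel_refl : reflexive glue_rel.
Proof. by move=> u; apply/asboolP; apply: rst_refl. Qed.

Lemma glue_rel_sym : symmetric glue_rel.
Proof. by move=> u v; apply/asboolP/asboolP; apply: rst_sym. Qed.

Lemma glue_rel_trans : transitive glue_rel.
Proof.
by move=> v u w /asboolP uv /asboolP vw; apply/asboolP; apply: rst_trans uv vw.
Qed.

Definition glue_equiv :=
  EquivRel glue_rel glue_rel_refl glue_rel_sym glue_rel_trans.

Definition glued_space : topologicalType :=
  quotient_topology {eq_quot glue_equiv}.

End connected_sum.

(** [X] is a connected sum [M # N] of the surfaces [M] and [N]: remove the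
    interior of an embedded closed disc from each and glue along the boundary
    circles.  As usual [M # N] is only meant up to homeomorphism: for the
    surfaces considered here the result does not depend on the discs.  (A change
    of the gluing homeomorphism extends over the disc by coning, so it is
    absorbed in the choice of [e2].) *)
Definition is_connected_sum (R : realType) (M N X : topologicalType) : Prop :=
  exists (e1 : disc R -> M) (e2 : disc R -> N),
    [/\ embedding e1, embedding e2 & homeomorphic (glued_space e1 e2) X].

(** [X] is a connected sum of [k >= 1] copies of [M]; nothing is for [k = 0]. *)
Inductive is_iterated_connected_sum (R : realType) (M : topologicalType) :
    nat -> topologicalType -> Prop :=
| ICS_one X : homeomorphic M X -> is_iterated_connected_sum R M 1 X
| ICS_add k Y X : is_iterated_connected_sum R M k Y ->
    is_connected_sum R Y M X -> is_iterated_connected_sum R M k.+1 X.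

(** [K] is the set of faces of a simplicial complex with vertex set all of
    [V]. *)
Definition is_simplicial_complex (V : finType) (K : {set {set V}}) : Prop :=
  [/\ finset.set0 \in K,
      forall v : V, [set v]%SET \in K
    & forall A B : {set V}, A \subset B -> B \in K -> A \in K].

Definition is_flag (V : finType) (K : {set {set V}}) : Prop :=
  forall A : {set V}, minset (fun B : {set V} => B \notin K) A -> #|A| = 2%N.

(** Barycentric coordinates; the topology on [{ptws V -> R}] is the product
    topology of [R^V]. *)
Definition realization_set (R : realType) (V : finType) (K : {set {set V}}) :
    set {ptws V -> R} :=
  [set x | [/\ forall v, 0 <= x v, \sum_v x v = 1
             & [set v | x v != 0]%SET \in K]].

Definition realization (R : realType) (V : finType) (K : {set {set V}}) :
    topologicalType :=
  set_type (@realization_set R V K).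

(** Since connected sums are defined up to homeomorphism, a surface is given as
    a class [S] of spaces. *)
Definition is_flag_triangulation (R : realType) (S : topologicalType -> Prop)
    (V : finType) (K : {set {set V}}) : Prop :=
  [/\ is_simplicial_complex K, is_flag K
    & exists2 X : topologicalType, S X & homeomorphic (realization R K) X].

Definition is_vertex_minimal_flag_triangulation (R : realType)
    (S : topologicalType -> Prop) (V : finType) (K : {set {set V}}) : Prop :=
  is_flag_triangulation R S K /\
  forall (W : finType) (L : {set {set W}}),
    is_flag_triangulation R S L -> (#|V| <= #|W|)%N.

(* Main.v *)
(** Clique complexes of graphs are flag.  If two graphs have vertices whose links are
    induced hexagons, then deleting these two vertices and identifying the hexagons
    gives a clique complex that triangulates the connected sum, because no clique can
    contain vertices from the interiors of both sides.  The number of vertices of the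
    sum is that of the two summands minus 8.  So it suffices to triangulate the torus
    with 12 and the projective plane with 11 vertices, each with two non-adjacent
    hexagonal vertices.

    Both triangulations are quotients of a polyhedron by the antipodal map.  For the
    torus, this is the product of a square and a hexagon; the quotient of
    [S^1 * S^1] by [-1] is again a torus, through [(z, w) |-> (z ^ 2, z w)].  For the
    projective plane, it is a complete fan in space whose rays are the nonzero
    vectors with entries in [{-1, 0, 1}] other than [(1, 0, 1)], [(1, 0, -1)] and
    their opposites.  In each case the barycentric coordinates are given by even
    piecewise linear functions on the covering surface.

    All the homeomorphisms are obtained from the same remark: two quotient maps
    with the same fibres have homeomorphic targets, and a continuous surjection from a
    compact space to a Hausdorff one is a quotient map. *)
Require Import Defs.
From HB Require Import structures.
From Stdlib Require Import Relations.
From mathcomp Require Import all_boot all_order all_algebra generic_quotient.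
From mathcomp Require Import all_classical all_reals all_analysis.
From mathcomp Require Import ring lra zify.

Set Implicit Arguments.
Unset Strict Implicit.
Unset Printing Implicit Defensive.

Import Order.TTheory GRing.Theory Num.Theory.
Import numFieldNormedType.Exports.

Local Open Scope classical_set_scope.
Local Open Scope ring_scope.
Local Open Scope quotient_scope.

(** * Quotient maps between compact spaces *)

(** The constant 8 is what one gluing loses: the two centres and one copy of the six rim vertices.
    So copies of a summand with 8 + m vertices give 8 + m k for every k, with m = 4 for the torus
    and m = 3 for the projective plane. Each gluing uses up one hexagonal star of the new summand,
    so a second one must survive; this is why the two centres must not be adjacent. Since both
    hexagons are induced, the two sides agree on which rim vertices are adjacent, and the
    identification creates no edge. The four omitted vectors are dictated by the hexagons. With all
    26 sign vectors as rays (the barycentric subdivision of the cube), the links of (0, 0, 1) and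
    (1, 0, 0) are octagons. Deleting (1, 0, 1), (1, 0, -1) and their opposites removes two vertices
    from each octagon and leaves 22 rays, hence 11 vertices. The quadrilaterals that appear are cut
    by the diagonal that does not join the two centres. *)

Section topology.

Lemma homeomorphic_refl (X : topologicalType) : homeomorphic X X.
Proof. by exists id, id; split => // x; exact: cvg_id. Qed.

Definition quotient_map (A B : topologicalType) (f : A -> B) : Prop :=
  [/\ continuous f, forall b, exists a, f a = b
    & forall U : set B, open (f @^-1` U) -> open U].

(** The chosen sections [s] and [t] need not be continuous. But [g \o s] becomes [g] after
    composition with [f], and the quotient topology tests openness after exactly this
    composition. *)
Lemma homeomorphic_of_quotient_maps (A B C : topologicalType)
    (f : A -> B) (g : A -> C) :
  quotient_map f -> quotient_map g -> (forall a b, f a = f b <-> g a = g b) ->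
  homeomorphic B C.
Proof.
move=> [fc fs fq] [gc gs gq] fg.
pose s b := projT1 (cid (fs b)); have sK b : f (s b) = b := projT2 (cid (fs b)).
pose t c := projT1 (cid (gs c)); have tK c : g (t c) = c := projT2 (cid (gs c)).
have gsf a : g (s (f a)) = g a by apply/fg; rewrite sK.
have ftg a : f (t (g a)) = f a by apply/fg; rewrite tK.
exists (g \o s), (f \o t); split.
- by move=> b /=; rewrite ftg.
- by move=> c /=; rewrite gsf.
- apply/continuousP => U oU; apply: fq.
  rewrite (_ : _ @^-1` _ = g @^-1` U); first by move/continuousP : gc; apply.
  by apply/seteqP; split => a /=; rewrite gsf.
- apply/continuousP => U oU; apply: gq.
  rewrite (_ : _ @^-1` _ = f @^-1` U); first by move/continuousP : fc; apply.
  by apply/seteqP; split => a /=; rewrite ftg.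
Qed.

Lemma compact_image (A B : topologicalType) (f : A -> B) (D : set A) :
  continuous f -> compact D -> compact (f @` D).
Proof. by move=> fc; apply: continuous_compact; exact: continuous_subspaceT. Qed.

Lemma compact_surj (A B : topologicalType) (f : A -> B) :
  continuous f -> (forall b, exists a, f a = b) ->
  compact [set: A] -> compact [set: B].
Proof.
move=> fc fs cA; rewrite (_ : setT = f @` setT); first exact: compact_image.
by apply/seteqP; split => // b _; have [a] := fs b; exists a.
Qed.

Lemma compact_hausdorff_image_closed (A B : topologicalType) (f : A -> B) :
  continuous f -> compact [set: A] -> hausdorff_space B ->
  forall D : set A, closed D -> closed (f @` D).
Proof.
move=> fc cA hB D cD; apply: compact_closed => //; apply: compact_image => //.
by apply: subclosed_compact cA _.
Qed.

Lemma compact_hausdorff_quotient_map (A B : topologicalType) (f : A -> B) :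
  continuous f -> (forall b, exists a, f a = b) ->
  compact [set: A] -> hausdorff_space B -> quotient_map f.
Proof.
move=> fc fs cA hB; split => // U oU.
have /(compact_hausdorff_image_closed fc cA hB) : closed (~` (f @^-1` U)).
  by rewrite closedC.
rewrite (_ : f @` _ = ~` U) ?closedC//.
apply/seteqP; split => [_ [a nU <-]//|b nU].
by have [a fa] := fs b; exists a => //=; rewrite fa.
Qed.

(** The image of the complement of [U] is closed; by injectivity, its complement cuts out exactly
    [U]. *)
Lemma compact_hausdorff_embedding (A B : topologicalType) (f : A -> B) :
  continuous f -> injective f -> compact [set: A] -> hausdorff_space B ->
  embedding f.
Proof.
move=> fc fi cA hB; split => // U oU.
exists (~` (f @` (~` U))).
  by rewrite openC; apply: compact_hausdorff_image_closed => //; rewrite closedC.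
apply/seteqP; split => a /=; first by apply: contra_notP => Ua; exists a.
by move=> Ua [b nUb /fi ba]; apply: nUb; rewrite ba.
Qed.

Lemma pi_quotient_map (A : topologicalType) (Q : quotType A) :
  quotient_map (\pi_(quotient_topology Q) : A -> quotient_topology Q).
Proof.
split; [exact: pi_continuous| |by []].
by move=> b; exists (repr b); rewrite reprK.
Qed.

Lemma hausdorff_inj (A B : topologicalType) (f : A -> B) :
  continuous f -> injective f -> hausdorff_space B -> hausdorff_space A.
Proof.
move=> fc fi hB x y xy; apply: fi; apply: hB => U V Ufx Vfy.
have [z [Uz Vz]] := xy _ _ (fc x U Ufx) (fc y V Vfy).
by exists (f z).
Qed.

Lemma val_continuous (X : topologicalType) (A : set X) :
  continuous (val : set_type A -> X).
Proof. exact: initial_continuous. Qed.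

Lemma continuous_set_type (X Y : topologicalType) (A : set X)
    (f : Y -> set_type A) :
  continuous (val \o f) -> continuous f.
Proof. exact: continuous_comp_initial. Qed.

Lemma set_type_hausdorff (X : topologicalType) (A : set X) :
  hausdorff_space X -> hausdorff_space (set_type A).
Proof. exact: hausdorff_inj (@val_continuous X A) val_inj. Qed.

(** A filter on the subtype is pushed forward along [val]; the cluster point found in [A] is then
    lifted back. *)
Lemma set_type_compact (X : topologicalType) (A : set X) :
  compact A -> compact [set: set_type A].
Proof.
move=> cA F PF _.
have /cA [p [Ap clp]] : (val @ F) A.
  by apply: (@filterS _ F _ setT); [move=> x _; apply: set_valP|exact: filterT].
exists (SigSub (mem_set Ap)); split=> //= U V FU.
move=> [_ [[W oW <-]]] /= Wp WV.
have [||q [[x Ux <-] Wq]] := clp (val @` U) W.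
- by apply: (@filterS _ F _ U) => // x Ux; exists x.
- exact: open_nbhs_nbhs.
by exists x; split => //; exact: WV.
Qed.

Lemma closed_set_type_compact (X : topologicalType) (A : set X) :
  compact [set: X] -> closed A -> compact [set: set_type A].
Proof. by move=> cX cA; apply: set_type_compact; apply: subclosed_compact cX _. Qed.

Lemma prod_compact (A B : topologicalType) :
  compact [set: A] -> compact [set: B] -> compact [set: (A * B)%type].
Proof. by move=> cA cB; rewrite -setXTT; exact: compact_setX. Qed.

Lemma ptws_continuous (Y : topologicalType) (I : eqType) (Z : topologicalType)
    (f : Y -> {ptws I -> Z}) :
  (forall i, continuous (fun y => f y i)) -> continuous f.
Proof.
(* The product topology is the supremum of the topologies induced by the evaluations; each
   evaluation is onto because of the constant functions. *)
move=> fc y; apply/cvg_sup => i; apply/cvg_image.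
  by rewrite eqEsubset; split => // z _; exists (fun=> z).
move=> U /= /(fc i y) fU; exists ((fun g => g i) @^-1` U) => //.
by apply/seteqP; split => [_ [g Ug <-]//|z Uz]; exists (fun=> z).
Qed.

Lemma ptws_hausdorff (I : eqType) (Z : topologicalType) :
  hausdorff_space Z -> hausdorff_space {ptws I -> Z}.
Proof. by move=> hZ; apply: (@hausdorff_product I (fun=> Z)). Qed.

Lemma ptws_eval_continuous (I : eqType) (Z : topologicalType) (i : I) :
  continuous (fun x : {ptws I -> Z} => x i).
Proof. exact: (@proj_continuous I (fun=> Z) i). Qed.

End topology.

(** * Continuity of real-valued functions *)

Section real_continuity.
Variables (R : realType) (T : topologicalType).
Implicit Types f g : T -> R.

Lemma cont_cst (c : R) : continuous (fun _ : T => c).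
Proof. by move=> x; exact: cvg_cst. Qed.

Lemma contD f g : continuous f -> continuous g -> continuous (fun x => f x + g x).
Proof. by move=> fc gc x; apply: cvgD; [exact: fc|exact: gc]. Qed.

Lemma contN f : continuous f -> continuous (fun x => - f x).
Proof. by move=> fc x; apply: cvgN; exact: fc. Qed.

Lemma contB f g : continuous f -> continuous g -> continuous (fun x => f x - g x).
Proof. by move=> fc gc; apply: contD => //; exact: contN. Qed.

Lemma contM f g : continuous f -> continuous g -> continuous (fun x => f x * g x).
Proof. by move=> fc gc x; apply: cvgM; [exact: fc|exact: gc]. Qed.

Lemma contV f : (forall x, f x != 0) -> continuous f ->
  continuous (fun x => (f x)^-1).
Proof. by move=> f0 fc x; apply: cvgV => //; exact: fc. Qed.

Lemma cont_div f g : (forall x, g x != 0) -> continuous f -> continuous g ->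
  continuous (fun x => f x / g x).
Proof. by move=> g0 fc gc; apply: contM => //; exact: contV. Qed.

Lemma cont_norm f : continuous f -> continuous (fun x => `|f x|).
Proof. by move=> fc x; apply: cvg_norm; exact: fc. Qed.

Lemma cont_max f g : continuous f -> continuous g ->
  continuous (fun x => Num.max (f x) (g x)).
Proof. by move=> fc gc x; apply: continuous_max; [exact: fc|exact: gc]. Qed.

Lemma cont_min f g : continuous f -> continuous g ->
  continuous (fun x => Num.min (f x) (g x)).
Proof. by move=> fc gc x; apply: continuous_min; [exact: fc|exact: gc]. Qed.

Lemma cont_sum (I : Type) (r : seq I) (P : pred I) (F : I -> T -> R) :
  (forall i, continuous (F i)) -> continuous (fun x => \sum_(i <- r | P i) F i x).
Proof.
move=> Fc; elim: r => [|i r IH].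
  by under eq_fun do rewrite big_nil; exact: cont_cst.
under eq_fun do rewrite big_cons.
by case: (P i) => //; apply: contD.
Qed.

Lemma contX f n : continuous f -> continuous (fun x => f x ^+ n).
Proof.
move=> fc; elim: n => [|n IH]; first by under eq_fun do rewrite expr0; exact: cont_cst.
by under eq_fun do rewrite exprS; apply: contM.
Qed.

End real_continuity.

(** * Discs, spheres and products: compactness and separation *)

Section matrices.
Variable R : realType.

Lemma rV_continuous (T : topologicalType) n (f : T -> 'rV[R]_n) :
  (forall j, continuous (fun x => f x ord0 j)) -> continuous f.
Proof.
move=> fc x U [P Pn PU].
suff : \forall y \near x, forall j, P ord0 j (f y ord0 j).
  by apply: filterS => y Py; apply: PU => i j; rewrite ord1.
by apply: filter_forall => j; apply: fc; exact: Pn.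
Qed.

Lemma rV_hausdorff n : hausdorff_space 'rV[R]_n.
Proof.
move=> x y xy; apply/rowP => j.
apply: (@Rhausdorff R) => U V Ux Vy.
have c (w : 'rV[R]_n) := @coord_continuous R 1 n ord0 j w.
have [||z [Uz Vz]] := xy ((fun M : 'rV[R]_n => M ord0 j) @^-1` U)
  ((fun M : 'rV[R]_n => M ord0 j) @^-1` V); [exact: c|exact: c|].
by exists (z ord0 j).
Qed.

Lemma sqnorm_continuous n : continuous (@sqnorm R n).
Proof. by apply: cont_sum => i; apply: contX; exact: coord_continuous. Qed.

Lemma sqnorm_bounded_closed_compact n (A : set 'rV[R]_n) :
  (forall x, A x -> sqnorm x <= 1) -> closed A -> compact A.
Proof.
move=> A1 cA; apply: bounded_closed_compact => //; exists 1; split => // M M1 x Ax.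
rewrite /Num.norm /= mx_normrE; apply: bigmax_le => [|[i j] _ /=].
  by apply: ltW; apply: lt_trans M1.
apply: ltW; apply: le_lt_trans M1; rewrite ord1.
rewrite -(@ler_pXn2r _ 2) ?nnegrE// expr1n -normrX ger0_norm ?sqr_ge0//.
apply: le_trans (A1 _ Ax); rewrite /sqnorm (bigD1 j) //= lerDl.
by apply: sumr_ge0 => k _; exact: sqr_ge0.
Qed.

Lemma disc_compact : compact [set: disc R].
Proof.
apply: set_type_compact; apply: sqnorm_bounded_closed_compact => //.
apply: (@closed_comp _ _ (@sqnorm R 2) [set t | t <= 1]) => [x _|].
  exact: sqnorm_continuous.
exact: closed_le.
Qed.

Lemma sphere_compact n : compact [set: sphere R n].
Proof.
apply: set_type_compact; apply: sqnorm_bounded_closed_compact => [x|].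
  by rewrite /unit_sphere /= => ->.
apply: (@closed_comp _ _ (@sqnorm R n.+1) [set t | t = 1]) => [x _|].
  exact: sqnorm_continuous.
exact: closed_eq.
Qed.

Lemma sphere_hausdorff n : hausdorff_space (sphere R n).
Proof. by apply: set_type_hausdorff; exact: rV_hausdorff. Qed.

Lemma prod_hausdorff (A B : topologicalType) :
  hausdorff_space A -> hausdorff_space B -> hausdorff_space (A * B)%type.
Proof.
move=> hA hB [a b] [c d] xy; congr (_, _).
- apply: hA => U V Ua Vc.
  have [||z [Uz Vz]] := xy (fst @^-1` U) (fst @^-1` V).
  + by apply: cvg_fst.
  + by apply: cvg_fst.
  by exists z.1.
- apply: hB => U V Ub Vd.
  have [||z [Uz Vz]] := xy (snd @^-1` U) (snd @^-1` V).
  + by apply: cvg_snd.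
  + by apply: cvg_snd.
  by exists z.2.
Qed.

End matrices.

(** * The hexagon and the cone over it *)

Lemma ord6_ind (P : 'I_6 -> Prop) :
  P (@Ordinal 6 0 isT) -> P (@Ordinal 6 1 isT) -> P (@Ordinal 6 2 isT) ->
  P (@Ordinal 6 3 isT) -> P (@Ordinal 6 4 isT) -> P (@Ordinal 6 5 isT) ->
  forall i, P i.
Proof.
move=> P0 P1 P2 P3 P4 P5 [[|[|[|[|[|[|//]]]]]] Hm];
  by rewrite (bool_irrelevance Hm isT).
Qed.

(** Addition in ['I_6] is modulo 6, so this is the 6-cycle. *)
Definition hex_adj (i j : 'I_6) : bool := (j == i + 1) || (i == j + 1).

Section hexagon.
Variable R : realType.

Definition rpos (t : R) : R := Num.max 0 t.

Lemma rposE t : 0 <= t -> rpos t = t. Proof. by move=> ?; rewrite /rpos max_r. Qed.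
Lemma rpos0 t : t <= 0 -> rpos t = 0. Proof. by move=> ?; rewrite /rpos max_l. Qed.
Lemma rpos_ge0 t : 0 <= rpos t. Proof. by rewrite /rpos le_max lexx. Qed.

Lemma rpos_continuous (T : topologicalType) (f : T -> R) :
  continuous f -> continuous (fun x => rpos (f x)).
Proof. by move=> fc; apply: cont_max => //; exact: cont_cst. Qed.

(** [hexc x y] lists the coordinates of [(x, y)] in the fan spanned by the six
    vectors [(hexx i, hexy i)]. *)
Definition hexx (i : 'I_6) : R := nth 0 [:: 1; 1; 0; -1; -1; 0] i.
Definition hexy (i : 'I_6) : R := nth 0 [:: 0; 1; 1; 0; -1; -1] i.

Definition hexc (x y : R) (i : 'I_6) : R :=
  rpos (nth 0 [:: Num.min x (x - y); Num.min x y; Num.min y (y - x);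
                 Num.min (- x) (y - x); Num.min (- x) (- y);
                 Num.min (- y) (x - y)] i).

Definition edge_coord (j : 'I_6) (a b : R) (i : 'I_6) : R :=
  a * (i == j)%:R + b * (i == j + 1)%:R.

Ltac minmax := repeat match goal with
  | |- context [Num.min ?a ?b] =>
      first [ rewrite (@min_l _ _ a b); last lra
            | rewrite (@min_r _ _ a b); last lra ]
  | |- context [rpos ?a] =>
      first [ rewrite (@rposE a); last lra | rewrite (@rpos0 a); last lra ]
  end.

(** A ray of the fan bounds two cones and its coordinate is a linear form on each. On their union it
    is the minimum of the two forms; elsewhere the truncation at 0 makes it vanish. All 36 pairs of
    a cone and a ray are linear arithmetic. *)
Lemma hexc_edge j a b : 0 <= a -> 0 <= b ->
  hexc (a * hexx j + b * hexx (j + 1)) (a * hexy j + b * hexy (j + 1)) =1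
  edge_coord j a b.
Proof.
move=> a0 b0.
elim/ord6_ind: j; apply: ord6_ind;
  rewrite /hexc /edge_coord /hexx /hexy /=; minmax; lra.
Qed.

Lemma hex_cover x y : exists j a b, [/\ 0 <= a, 0 <= b,
  x = a * hexx j + b * hexx (j + 1) & y = a * hexy j + b * hexy (j + 1)].
Proof.
have [y0|y0] := leP 0 y; have [x0|x0] := leP 0 x.
- have [xy|xy] := leP y x.
  + exists (@Ordinal 6 0 isT), (x - y), y; rewrite /hexx /hexy /=; split; lra.
  + exists (@Ordinal 6 1 isT), x, (y - x); rewrite /hexx /hexy /=; split; lra.
- exists (@Ordinal 6 2 isT), y, (- x); rewrite /hexx /hexy /=; split; lra.
- exists (@Ordinal 6 5 isT), (- y), x; rewrite /hexx /hexy /=; split; lra.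
- have [xy|xy] := leP y x.
  + exists (@Ordinal 6 4 isT), (- x), (x - y); rewrite /hexx /hexy /=; split; lra.
  + exists (@Ordinal 6 3 isT), (y - x), (- y); rewrite /hexx /hexy /=; split; lra.
Qed.

Lemma hexcP x y : exists j a b, [/\ 0 <= a, 0 <= b,
  x = a * hexx j + b * hexx (j + 1), y = a * hexy j + b * hexy (j + 1)
  & hexc x y =1 edge_coord j a b].
Proof.
have [j [a [b [a0 b0 -> ->]]]] := hex_cover x y.
by exists j, a, b; split => //; exact: hexc_edge.
Qed.

Lemma sum_edge_coord j a b (F : 'I_6 -> R) :
  \sum_i edge_coord j a b i * F i = a * F j + b * F (j + 1).
Proof.
rewrite /edge_coord; under eq_bigr do rewrite mulrDl -!mulrA.
rewrite big_split /= -!big_distrr /=; congr (_ * _ + _ * _).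
  by rewrite (bigD1 j) //= eqxx mul1r big1 ?addr0// => i /negPf ->; rewrite mul0r.
by rewrite (bigD1 (j + 1)) //= eqxx mul1r big1 ?addr0// => i /negPf ->; rewrite mul0r.
Qed.

Lemma hexc_ge0 x y i : 0 <= hexc x y i. Proof. exact: rpos_ge0. Qed.

Lemma hexc_x x y : \sum_i hexc x y i * hexx i = x.
Proof.
have [j [a [b [_ _ ex _ h]]]] := hexcP x y.
by under eq_bigr do rewrite h; rewrite sum_edge_coord -ex.
Qed.

Lemma hexc_y x y : \sum_i hexc x y i * hexy i = y.
Proof.
have [j [a [b [_ _ _ ey h]]]] := hexcP x y.
by under eq_bigr do rewrite h; rewrite sum_edge_coord -ey.
Qed.

Lemma hexc_continuous (T : topologicalType) (f g : T -> R) i :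
  continuous f -> continuous g -> continuous (fun t => hexc (f t) (g t) i).
Proof.
move=> fc gc; have fNc := contN fc; have gNc := contN gc.
have fgc := contB fc gc; have gfc := contB gc fc.
by apply: rpos_continuous; elim/ord6_ind: i => /=; apply: cont_min.
Qed.

Definition hexn (x y : R) : R := \sum_i hexc x y i.

Lemma hexn_ge0 x y : 0 <= hexn x y.
Proof. by apply: sumr_ge0 => i _; exact: hexc_ge0. Qed.

Lemma hexn_gt0 x y : (x != 0) || (y != 0) -> 0 < hexn x y.
Proof.
move=> xy; rewrite lt_neqAle hexn_ge0 andbT eq_sym; apply/negP => /eqP n0.
have h0 i : hexc x y i = 0.
  by move/eqP : n0; rewrite psumr_eq0 => [/allP/(_ i)|k _];
    [rewrite mem_index_enum => /(_ isT)/eqP|exact: hexc_ge0].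
have x0 : x = 0.
  by apply: etrans (esym (hexc_x x y)) _; rewrite big1// => i _; rewrite h0 mul0r.
have y0 : y = 0.
  by apply: etrans (esym (hexc_y x y)) _; rewrite big1// => i _; rewrite h0 mul0r.
by move: xy; rewrite x0 y0 eqxx.
Qed.

Lemma hexn_continuous (T : topologicalType) (f g : T -> R) :
  continuous f -> continuous g -> continuous (fun t => hexn (f t) (g t)).
Proof. by move=> fc gc; apply: cont_sum => i; exact: hexc_continuous. Qed.

Lemma hexcZ c x y i : 0 <= c -> hexc (c * x) (c * y) i = c * hexc x y i.
Proof.
move=> c0; have [j [a [b [a0 b0 -> -> ->]]]] := hexcP x y.
rewrite 2!mulrDr !mulrA hexc_edge ?mulr_ge0// /edge_coord; ring.
Qed.

Lemma hexcN x y i : hexc (- x) (- y) i = hexc x y (i + 3).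
Proof. by elim/ord6_ind: i; rewrite /hexc /=; congr rpos; congr Num.min; ring. Qed.

Lemma edge_coord_ge0 j a b i : 0 <= a -> 0 <= b -> 0 <= edge_coord j a b i.
Proof. by move=> a0 b0; rewrite addr_ge0 ?mulr_ge0. Qed.

Lemma edge_coord_adj j a b i k : edge_coord j a b i != 0 ->
  edge_coord j a b k != 0 -> i != k -> hex_adj i k.
Proof.
rewrite /edge_coord /hex_adj.
have [->|ij] := eqVneq i j; have [->|kj] := eqVneq k j => //=.
- by have [->|] := eqVneq k (j + 1); rewrite ?eqxx ?mulr0 ?addr0 ?eqxx.
- by have [->|] := eqVneq i (j + 1); rewrite ?eqxx ?orbT ?mulr0 ?addr0 ?eqxx.
have [->|] := eqVneq i (j + 1); rewrite ?mulr0 ?addr0 ?eqxx//.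
by have [->|] := eqVneq k (j + 1); rewrite ?mulr0 ?addr0 ?eqxx.
Qed.

Lemma hex_clique_edge (s : 'I_6 -> R) : (forall i, 0 <= s i) ->
  (forall i k, s i != 0 -> s k != 0 -> i != k -> hex_adj i k) ->
  exists j a b, [/\ 0 <= a, 0 <= b & s =1 edge_coord j a b].
Proof.
move=> s0 sK.
have [[j sj]|] := pselect (exists j, s j != 0); last first.
  move=> /forallNP s_0; exists 0, 0, 0; split => // i.
  by rewrite /edge_coord !mul0r addr0; apply/eqP; apply: contra_notT (s_0 i).
have sK' i k : ~~ hex_adj i k -> i != k -> s i != 0 -> s k = 0.
  by move=> ik nik si; apply/eqP; apply: contraNT ik => sk; exact: sK.
have [sj1|sj1] := eqVneq (s (j + 1)) 0; last first.
  exists j, (s j), (s (j + 1)); split => // i; rewrite /edge_coord.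
  have [->|ij] := eqVneq i j.
    by rewrite (_ : j == j + 1 = false) ?mulr1 ?mulr0 ?addr0//; elim/ord6_ind: {+}j.
  have [->|ij1] := eqVneq i (j + 1); first by rewrite mulr0 add0r mulr1.
  rewrite !mulr0 addr0.
  suff /orP[A|A] : ~~ hex_adj j i || ~~ hex_adj (j + 1) i.
  - by apply: sK' A _ sj; rewrite eq_sym.
  - by apply: sK' A _ sj1; rewrite eq_sym.
  by move: ij ij1; elim/ord6_ind: {+}j; elim/ord6_ind: {+}i.
exists (j - 1), (s (j - 1)), (s j); split => // i.
rewrite /edge_coord subrK.
have [->|ij] := eqVneq i j.
  by rewrite (_ : j == j - 1 = false) ?mulr1 ?mulr0 ?add0r//; elim/ord6_ind: {+}j.
have [->|ij1] := eqVneq i (j - 1); first by rewrite mulr0 addr0 mulr1.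
rewrite !mulr0 addr0.
have [->//|ij2] := eqVneq i (j + 1).
apply: sK' _ _ sj; last by rewrite eq_sym.
by move: ij ij1 ij2; elim/ord6_ind: {+}j; elim/ord6_ind: {+}i.
Qed.

End hexagon.

(** * The closed disc as the cone over the hexagon *)

Section disc_model.
Variable R : realType.
Implicit Types x y : R.

(** Dividing by [1 - |p|^2 + hexn p], rather than rescaling radially, keeps the
    parametrization of the cone continuous at the centre of the disc. *)
Definition disc_den x y : R := 1 - (x ^+ 2 + y ^+ 2) + hexn x y.
Definition disc_apex x y : R := (1 - (x ^+ 2 + y ^+ 2)) / disc_den x y.
Definition disc_rim x y (i : 'I_6) : R := hexc x y i / disc_den x y.

Section in_disc.
Variables x y : R.
Hypothesis xy1 : x ^+ 2 + y ^+ 2 <= 1.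

Lemma disc_den_gt0 : 0 < disc_den x y.
Proof.
move: xy1; rewrite -subr_ge0 /disc_den; have [->|x0] := eqVneq x 0; last first.
  by move=> xy0; rewrite ltr_wpDl// hexn_gt0 ?x0.
have [->|y0] := eqVneq y 0 => xy0; last by rewrite ltr_wpDl// hexn_gt0 ?y0 ?orbT.
by rewrite expr0n /= addr0 subr0 ltr_pwDl// hexn_ge0.
Qed.

Lemma disc_apex_ge0 : 0 <= disc_apex x y.
Proof. by rewrite divr_ge0 ?subr_ge0// ltW// disc_den_gt0. Qed.

Lemma disc_rim_ge0 i : 0 <= disc_rim x y i.
Proof. by rewrite divr_ge0 ?hexc_ge0// ltW// disc_den_gt0. Qed.

Lemma disc_coord_sum : disc_apex x y + \sum_i disc_rim x y i = 1.
Proof.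
by rewrite -big_distrl -mulrDl divff// gt_eqF// disc_den_gt0.
Qed.

Lemma disc_rim_adj i k : disc_rim x y i != 0 -> disc_rim x y k != 0 ->
  i != k -> hex_adj i k.
Proof.
have [j [a [b [_ _ _ _ h]]]] := hexcP x y.
rewrite /disc_rim !mulf_eq0 !negb_or !h => /andP[h1 _] /andP[h2 _].
exact: edge_coord_adj h1 h2.
Qed.

Lemma disc_apex_eq0 : (disc_apex x y == 0) = (x ^+ 2 + y ^+ 2 == 1).
Proof.
by rewrite mulf_eq0 invr_eq0 (gt_eqF disc_den_gt0) orbF subr_eq0 eq_sym.
Qed.

End in_disc.

(** Equal coordinates make the points proportional, with the ratio [c] of the denominators as
    factor. The apex coordinate then gives a quadratic equation for [c] whose only positive root is
    1. *)
Lemma disc_model_inj x y x' y' : x ^+ 2 + y ^+ 2 <= 1 -> x' ^+ 2 + y' ^+ 2 <= 1 ->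
  disc_apex x y = disc_apex x' y' -> disc_rim x y =1 disc_rim x' y' ->
  x = x' /\ y = y'.
Proof.
move=> xy1 xy1' eA eB.
have D0 := disc_den_gt0 xy1; have D0' := disc_den_gt0 xy1'.
pose c := disc_den x y / disc_den x' y'.
have c0 : 0 < c by rewrite divr_gt0.
have eh i : hexc x y i = c * hexc x' y' i.
  have := eB i; rewrite /disc_rim => /(canRL (divfK (lt0r_neq0 D0))) ->.
  by rewrite /c; ring.
have ex : x = c * x'.
  rewrite -[LHS](hexc_x x y) -[in RHS](hexc_x x' y') big_distrr/=.
  by apply: eq_bigr => i _; rewrite eh mulrA.
have ey : y = c * y'.
  rewrite -[LHS](hexc_y x y) -[in RHS](hexc_y x' y') big_distrr/=.
  by apply: eq_bigr => i _; rewrite eh mulrA.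
have ea : 1 - (x ^+ 2 + y ^+ 2) = c * (1 - (x' ^+ 2 + y' ^+ 2)).
  by move: eA; rewrite /disc_apex => /(canRL (divfK (lt0r_neq0 D0))) ->; rewrite /c; ring.
have : (1 - c) * (1 + c * (x' ^+ 2 + y' ^+ 2)) = 0.
  by move: ea; rewrite ex ey => ea; rewrite -(subrr (1 - ((c * x') ^+ 2 + (c * y') ^+ 2))) {2}ea; ring.
move/eqP; rewrite mulf_eq0 => /orP[|].
  by rewrite subr_eq0 => /eqP c1; rewrite ex ey -c1 !mul1r.
have : 0 < 1 + c * (x' ^+ 2 + y' ^+ 2).
  by rewrite ltr_pwDl// mulr_ge0 ?(ltW c0)// addr_ge0// sqr_ge0.
by move=> /gt_eqF ->.
Qed.

(** Let [(x0, y0)] have hexagon coordinates [s]. The preimage is sought as [(t * x0, t * y0)]; the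
    rim coordinates are right when the denominator equals [t], which amounts to
    [q * t ^+ 2 + s0 * t = 1]. *)
Lemma disc_model_surj (s0 : R) (s : 'I_6 -> R) : 0 <= s0 -> (forall i, 0 <= s i) ->
  s0 + \sum_i s i = 1 ->
  (forall i k, s i != 0 -> s k != 0 -> i != k -> hex_adj i k) ->
  exists x y, [/\ x ^+ 2 + y ^+ 2 <= 1, disc_apex x y = s0 & disc_rim x y =1 s].
Proof.
move=> s00 s_ge0 s1 sK.
have [j [a [b [a0 b0 es]]]] := hex_clique_edge s_ge0 sK.
pose x0 := a * hexx R j + b * hexx R (j + 1).
pose y0 := a * hexy R j + b * hexy R (j + 1).
pose q := x0 ^+ 2 + y0 ^+ 2.
have hs i : hexc x0 y0 i = s i by rewrite es; exact: hexc_edge.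
have q0 : 0 <= q by rewrite addr_ge0// sqr_ge0.
pose r := Num.sqrt (s0 ^+ 2 + 4 * q).
have r0 : 0 <= r by exact: sqrtr_ge0.
have r2 : r ^+ 2 = s0 ^+ 2 + 4 * q.
  by rewrite sqr_sqrtr// addr_ge0 ?sqr_ge0 ?mulr_ge0.
have sr0 : 0 < s0 + r.
  rewrite lt_neqAle addr_ge0// andbT eq_sym; apply/negP.
  rewrite paddr_eq0// => /andP[/eqP s00' /eqP r00].
  have : q = 0 by move: r2; rewrite s00' r00; lra.
  move/eqP; rewrite paddr_eq0 ?sqr_ge0// !sqrf_eq0 => /andP[/eqP x00 /eqP y00].
  move: s1; rewrite s00' add0r big1 => [/eqP|i _]; first by rewrite eq_sym oner_eq0.
  by rewrite -hs x00 y00; have := hexcZ 0 0 i (lexx (0 : R)); rewrite !mul0r.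
(* The positive root of that quadratic, with the square root moved to the denominator so that
   [q = 0] is covered. *)
pose t := 2 / (s0 + r).
have t0 : 0 < t by rewrite divr_gt0.
have tE : 1 - t ^+ 2 * q = t * s0.
  have -> : q = (r ^+ 2 - s0 ^+ 2) / 4 by rewrite r2; field.
  rewrite /t; field; exact: lt0r_neq0.
exists (t * x0), (t * y0).
have E : (t * x0) ^+ 2 + (t * y0) ^+ 2 = t ^+ 2 * q by rewrite /q; ring.
have D : disc_den (t * x0) (t * y0) = t.
  rewrite /disc_den E tE /hexn; under eq_bigr do rewrite hexcZ ?(ltW t0)// hs.
  by rewrite -big_distrr -mulrDr s1 mulr1.
have tn0 := lt0r_neq0 t0.
split.
- by rewrite E -subr_ge0 tE mulr_ge0// ltW.
- by rewrite /disc_apex D E tE mulrAC divff// mul1r.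
- by move=> i; rewrite /disc_rim D hexcZ ?(ltW t0)// hs mulrAC divff// mul1r.
Qed.

End disc_model.

(** * Clique complexes and their hexagonal stars *)

Definition clique_complex (V : finType) (adj : rel V) : {set {set V}} :=
  [set A : {set V} | [forall u in A, forall v in A, (u != v) ==> adj u v]]%SET.

Lemma clique_complexP (V : finType) (adj : rel V) (A : {set V}) :
  reflect (forall u v, u \in A -> v \in A -> u != v -> adj u v)
          (A \in clique_complex adj).
Proof.
rewrite inE; apply: (iffP forall_inP) => [H u v uA vA|H u uA].
  by have /forall_inP/(_ v vA)/implyP := H u uA.
by apply/forall_inP => v vA; apply/implyP; exact: H.
Qed.

Lemma clique_complex_simplicial (V : finType) (adj : rel V) :
  is_simplicial_complex (clique_complex adj).
Proof.
split=> [|v|A B AB /clique_complexP KB]; apply/clique_complexP => u w.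
- by rewrite inE.
- by rewrite !inE => /eqP -> /eqP ->; rewrite eqxx.
- by move=> /(fintype.subsetP AB) uB /(fintype.subsetP AB) wB; exact: KB.
Qed.

(** A non-clique contains a non-adjacent pair, which is already a non-face; by minimality it is the
    whole set. *)
Lemma clique_complex_flag (V : finType) (adj : rel V) :
  is_flag (clique_complex adj).
Proof.
move=> A /minsetP[/clique_complexP nKA minA].
have [[u [v [uA vA uv nadj]]]|noedge] :=
    pselect (exists u v, [/\ u \in A, v \in A, u != v & ~~ adj u v]).
  have <- : [set u; v]%SET = A.
    apply: minA; last by apply/fintype.subsetP => w; rewrite !inE => /orP[]/eqP ->.
    apply/clique_complexP => /(_ u v); rewrite !inE !eqxx orbT => /(_ isT isT uv).
    exact/negP.
  by rewrite cards2 uv.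
exfalso; apply: nKA => u v uA vA uv; apply/negPn/negP => nadj.
by apply: noedge; exists u, v.
Qed.

(** * Barycentric coordinates on the realization of a clique complex *)

Section realization.
Variables (R : realType) (V : finType) (adj : rel V).
Let X := realization R (clique_complex adj).

Definition barycentric (x : V -> R) : Prop :=
  [/\ forall v, 0 <= x v, \sum_v x v = 1
    & forall u v, x u != 0 -> x v != 0 -> u != v -> adj u v].

Lemma realization_setP (x : V -> R) :
  realization_set (clique_complex adj) x <-> barycentric x.
Proof.
split=> [[x0 x1 /clique_complexP xK]|[x0 x1 xK]]; split => //.
  by move=> u v xu xv; apply: xK; rewrite inE.
by apply/clique_complexP => u v; rewrite !inE; exact: xK.
Qed.

Definition bary (x : X) : V -> R := val x.

Lemma baryP (x : X) : barycentric (bary x).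
Proof. by apply/realization_setP; exact: set_valP. Qed.

Definition bary_point (x : V -> R) (gx : barycentric x) : X :=
  SigSub (mem_set ((realization_setP x).2 gx)).

Lemma bary_pointK x (gx : barycentric x) : bary (bary_point gx) = x.
Proof. by []. Qed.

Lemma bary_inj (x y : X) : bary x =1 bary y -> x = y.
Proof. by move=> xy; apply: val_inj; apply/funext. Qed.

Lemma bary_continuous v : continuous (fun x : X => bary x v).
Proof.
move=> x; apply: (@continuous_comp _ _ _ (val : X -> {ptws V -> R})
  (fun f : {ptws V -> R} => f v)).
  exact: val_continuous.
exact: ptws_eval_continuous.
Qed.

Lemma to_realization_continuous (T : topologicalType) (f : T -> X) :
  (forall v, continuous (fun t => bary (f t) v)) -> continuous f.
Proof. by move=> fc; apply: continuous_set_type; exact: ptws_continuous. Qed.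

Lemma realization_hausdorff : hausdorff_space X.
Proof. by apply: set_type_hausdorff; apply: ptws_hausdorff; exact: Rhausdorff. Qed.

End realization.

Definition vec2 (R : realType) (x y : R) : 'rV[R]_2 :=
  \row_j (if j == ord0 then x else y).

Lemma sqnorm2 (R : realType) (v : 'rV[R]_2) :
  sqnorm v = v ord0 ord0 ^+ 2 + v ord0 ord_max ^+ 2.
Proof.
rewrite /sqnorm big_ord_recl big_ord1; congr (_ + v _ _ ^+ 2).
exact: val_inj.
Qed.

Lemma row2P (R : realType) (v w : 'rV[R]_2) :
  v ord0 ord0 = w ord0 ord0 -> v ord0 ord_max = w ord0 ord_max -> v = w.
Proof.
move=> v0 v1; apply/rowP => -[[|[|//]] Hm].
  by rewrite (_ : Ordinal Hm = ord0)//; exact: val_inj.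
by rewrite (_ : Ordinal Hm = ord_max)//; exact: val_inj.
Qed.

Lemma vec2_0 (R : realType) (x y : R) : vec2 x y ord0 ord0 = x.
Proof. by rewrite mxE. Qed.

Lemma vec2_1 (R : realType) (x y : R) : vec2 x y ord0 ord_max = y.
Proof. by rewrite mxE. Qed.

(** In the clique complex of [adj], the link of [v] is the induced hexagon
    [c 0, ..., c 5], in this cyclic order. *)
Definition hex_star (V : finType) (adj : rel V) (v : V) (c : 'I_6 -> V) : Prop :=
  [/\ injective c, forall i, c i != v,
      forall w, (adj v w -> exists i, w = c i) /\ (adj w v -> exists i, w = c i),
      forall i, adj v (c i) /\ adj (c i) v
    & forall i k, i != k -> adj (c i) (c k) = hex_adj i k].

(** * The closed star of a hexagonal vertex as an embedded disc *)

Section star.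
Variables (R : realType) (V : finType) (adj : rel V) (v : V) (c : 'I_6 -> V).
Hypothesis star : hex_star adj v c.
Let X := realization R (clique_complex adj).

Definition star_point (d : disc R) (w : V) : R :=
  disc_apex (val d ord0 ord0) (val d ord0 ord_max) * (v == w)%:R +
  \sum_i disc_rim (val d ord0 ord0) (val d ord0 ord_max) i * (c i == w)%:R.

Lemma disc_le1 (d : disc R) : val d ord0 ord0 ^+ 2 + val d ord0 ord_max ^+ 2 <= 1.
Proof. by rewrite -sqnorm2; exact: (set_valP d). Qed.

Lemma star_point_center d :
  star_point d v = disc_apex (val d ord0 ord0) (val d ord0 ord_max).
Proof.
case: star => _ cv _ _ _; rewrite /star_point eqxx mulr1 big1 ?addr0// => i _.
by rewrite (negPf (cv i)) mulr0.
Qed.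

Lemma star_point_rim d i :
  star_point d (c i) = disc_rim (val d ord0 ord0) (val d ord0 ord_max) i.
Proof.
case: star => ci cv _ _ _; rewrite /star_point eq_sym (negPf (cv i)) mulr0 add0r.
rewrite (bigD1 i) //= eqxx mulr1 big1 ?addr0// => k ki.
by rewrite (inj_eq ci) (negPf ki) mulr0.
Qed.

Lemma star_point_out d w : w != v -> (forall i, w != c i) -> star_point d w = 0.
Proof.
move=> wv wc; rewrite /star_point eq_sym (negPf wv) mulr0 add0r big1// => i _.
by rewrite eq_sym (negPf (wc i)) mulr0.
Qed.

Lemma in_starP w : [\/ w = v, exists i, w = c i | w != v /\ forall i, w != c i].
Proof.
have [->|wv] := eqVneq w v; first by apply: Or31.
have [h|h] := pselect (exists i, w = c i); first by apply: Or32.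
by apply: Or33; split => // i; apply/eqP => e; apply: h; exists i.
Qed.

Lemma star_point_geometric d : barycentric adj (star_point d).
Proof.
case: (star) => ci cv vout vc cc; have d1 := disc_le1 d; split.
- move=> w; apply: addr_ge0; first by rewrite mulr_ge0// disc_apex_ge0.
  by apply: sumr_ge0 => i _; rewrite mulr_ge0// disc_rim_ge0.
- rewrite big_split exchange_big /= -[RHS](disc_coord_sum d1); congr (_ + _).
    rewrite (bigD1 v)//= eqxx mulr1 big1 ?addr0// => w wv.
    by rewrite eq_sym (negPf wv) mulr0.
  apply: eq_bigr => i _; rewrite (bigD1 (c i))//= eqxx mulr1.
  by rewrite big1 ?addr0// => w wv; rewrite eq_sym (negPf wv) mulr0.
- move=> u w.
  have [->|[i ->]|[u1 u2]] := in_starP u; have [->|[k ->]|[w1 w2]] := in_starP w;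
    rewrite ?(star_point_out _ u1 u2) ?(star_point_out _ w1 w2) ?eqxx//.
  + by move=> _ _ _; apply: (vc k).1.
  + by move=> _ _ _; apply: (vc i).2.
  + rewrite !star_point_rim (inj_eq ci) => h1 h2 ik.
    by rewrite cc// (disc_rim_adj h1 h2).
Qed.

Definition star_emb (d : disc R) : X := bary_point (star_point_geometric d).

Lemma star_embE d w : bary (star_emb d) w = star_point d w.
Proof. by []. Qed.

Lemma star_emb_inj : injective star_emb.
Proof.
move=> d d' /(congr1 (@bary _ _ _)); rewrite !bary_pointK => e.
have [|i|e0 e1] := disc_model_inj (disc_le1 d) (disc_le1 d').
- by rewrite -!star_point_center e.
- by rewrite -!star_point_rim e.
- by apply: val_inj; exact: row2P.
Qed.

Lemma disc_coord_continuous (j : 'I_2) :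
  continuous (fun d : disc R => val d ord0 j).
Proof.
move=> d; apply: (@continuous_comp _ _ _ (val : disc R -> 'rV[R]_2)
  (fun f : 'rV[R]_2 => f ord0 j)).
  exact: val_continuous.
exact: coord_continuous.
Qed.

Lemma star_emb_continuous : continuous star_emb.
Proof.
have xc := @disc_coord_continuous ord0; have yc := @disc_coord_continuous ord_max.
have qc : continuous (fun d : disc R =>
    1 - (val d ord0 ord0 ^+ 2 + val d ord0 ord_max ^+ 2)).
  by apply: contB; [exact: cont_cst|apply: contD; exact: contX].
have D0 (d : disc R) := lt0r_neq0 (disc_den_gt0 (disc_le1 d)).
have Dc : continuous (fun d : disc R =>
    disc_den (val d ord0 ord0) (val d ord0 ord_max)).
  by apply: contD => //; exact: hexn_continuous.
apply: to_realization_continuous => w; apply: contD.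
  by apply: contM; [exact: cont_div|exact: cont_cst].
apply: cont_sum => i; apply: contM; last exact: cont_cst.
by apply: cont_div => //; exact: hexc_continuous.
Qed.

Lemma star_emb_embedding : embedding star_emb.
Proof.
apply: compact_hausdorff_embedding.
- exact: star_emb_continuous.
- exact: star_emb_inj.
- exact: disc_compact.
- exact: realization_hausdorff.
Qed.

(** Because the link is induced, the clique condition on the rim weights is stated by [hex_adj], and
    [disc_model_surj] provides the point of the disc. *)
Lemma star_emb_surj (x : X) :
  (forall w, w != v -> (forall i, w != c i) -> bary x w = 0) ->
  exists d, star_emb d = x.
Proof.
case: (star) => ci cv vout vc cc xout; have [x0 x1 xK] := baryP x.
have [|i||i k h1 h2 ik|p [q [pq eA eB]]] := @disc_model_surj R (bary x v) (bary x \o c).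
- exact: x0.
- exact: x0.
- rewrite -x1 [RHS](bigD1 v)//=; congr (_ + _).
  rewrite (bigID (fun w => w \in codom c)) /= [X in _ = _ + X]big1 ?addr0; last first.
    move=> w /andP[wv wc]; apply: xout => // i.
    by apply: contraNneq wc => ->; exact: codom_f.
  rewrite (eq_bigl (fun w => w \in c @: 'I_6)) ?big_imset//=.
    by move=> i k _ _; exact: ci.
  move=> w; apply/andP/imsetP => [[_ /codomP[i ->]]|[i _ ->]]; first by exists i.
  by rewrite cv codom_f.
- by rewrite -cc//; apply: xK; rewrite ?(inj_eq ci).
have pq' : unit_ball (vec2 p q) by rewrite /unit_ball/= sqnorm2 vec2_0 vec2_1.
exists (SigSub (mem_set pq')); apply: bary_inj => w; rewrite bary_pointK.
have [->|[i ->]|[w1 w2]] := in_starP w.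
- by rewrite star_point_center SubK vec2_0 vec2_1.
- by rewrite star_point_rim SubK vec2_0 vec2_1 eB.
- by rewrite star_point_out// xout.
Qed.

Lemma star_emb_boundary d : (bary (star_emb d) v == 0) = (sqnorm (val d) == 1).
Proof.
by rewrite bary_pointK star_point_center disc_apex_eq0 ?disc_le1// sqnorm2.
Qed.

(** The open star of [v]. If [v] is in the support, every other support vertex is adjacent to [v]
    and hence on the rim, so the point belongs to the closed star. *)
Lemma star_emb_interior :
  star_emb @` @open_disc R = [set x : X | bary x v != 0].
Proof.
case: (star) => ci cv vout vc cc; apply/seteqP; split=> [_ [d d1 <-]|x xv] /=.
  by rewrite star_emb_boundary; move: d1; rewrite /open_disc/= => /lt_eqF ->.
have [x0 x1 xK] := baryP x.
have [w wv wc|d dx] := @star_emb_surj x.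
  apply/eqP; apply: contraT => xw.
  have /(vout w).2 [i wi] : adj w v by exact: xK.
  by move: (wc i); rewrite wi eqxx.
exists d => //; rewrite /open_disc /= lt_neqAle -star_emb_boundary dx xv /=.
exact: (set_valP d).
Qed.

End star.

(** * Gluing along hexagonal links *)

Section gluing.
Variables (V1 V2 : finType) (adj1 : rel V1) (adj2 : rel V2).
Variables (v1 : V1) (c1 : 'I_6 -> V1) (v2 : V2) (c2 : 'I_6 -> V2).
Hypothesis star1 : hex_star adj1 v1 c1.
Hypothesis star2 : hex_star adj2 v2 c2.

(** The rim [c1 i = c2 i] is represented by vertices of the left summand. *)
Definition glue_left : finType := {u : V1 | u \in predC1 v1}.
Definition off_star2 : pred V2 := [pred w | (w != v2) && (w \notin codom c2)].
Definition glue_right : finType := {w : V2 | w \in off_star2}.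
Definition glue_vertex : finType := (glue_left + glue_right)%type.

(** Both orders of arguments get their own relation because [adj2] need not be symmetric. *)
Definition cross_adj (u : V1) (w : V2) : bool :=
  [exists i, (c1 i == u) && adj2 (c2 i) w].
Definition cross_adj' (u : V1) (w : V2) : bool :=
  [exists i, (c1 i == u) && adj2 w (c2 i)].

Definition glue_adj (s t : glue_vertex) : bool :=
  match s, t with
  | inl u, inl u' => adj1 (val u) (val u')
  | inr w, inr w' => adj2 (val w) (val w')
  | inl u, inr w => cross_adj (val u) (val w)
  | inr w, inl u => cross_adj' (val u) (val w)
  end.

Lemma glue_vertex_card : (#|glue_vertex| + 8 = #|V1| + #|V2|)%N.
Proof.
case: star2 => ci cv _ _ _.
rewrite card_sum !card_sig.
have -> : #|[pred x | x \in predC1 v1]| = #|V1|.-1.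
  by rewrite -(cardC1 v1); apply: eq_card.
have e2 : (#|[pred x | x \in off_star2]| + 7 = #|V2|)%N.
  rewrite -(cardC (mem (v2 :: codom c2))) addnC; congr (_ + _)%N.
    have /card_uniqP -> /= : uniq (v2 :: codom c2).
      rewrite /= (map_inj_uniq ci) enum_uniq andbT.
      by apply/negP => /codomP[i e]; move: (cv i); rewrite -e eqxx.
    by rewrite size_codom card_ord.
  by apply: eq_card => x; rewrite !inE negb_or.
have : (0 < #|V1|)%N by apply/card_gt0P; exists v1.
by rewrite -e2; lia.
Qed.

Section coordinates.
Variable R : realType.

Definition left_coord (x : V1 -> R) (s : glue_vertex) : R :=
  if s is inl u then x (val u) else 0.

(** Transport of rim weights from the right to the left. A sum of indicators stands in for the
    inverse of [c1], so continuity is that of a finite sum. *)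
Definition rim_coord (h : V2 -> R) (u : V1) : R :=
  \sum_i (c1 i == u)%:R * h (c2 i).

Definition right_coord (h : V2 -> R) (s : glue_vertex) : R :=
  match s with inl u => rim_coord h (val u) | inr w => h (val w) end.

Lemma rim_coordE h i : rim_coord h (c1 i) = h (c2 i).
Proof.
case: star1 => ci _ _ _ _; rewrite /rim_coord (bigD1 i)//= eqxx mul1r.
by rewrite big1 ?addr0// => k ki; rewrite (inj_eq ci) (negPf ki) mul0r.
Qed.

Lemma rim_coord_out h u : (forall i, u != c1 i) -> rim_coord h u = 0.
Proof.
by move=> uc; rewrite /rim_coord big1// => i _; rewrite eq_sym (negPf (uc i)) mul0r.
Qed.

Lemma rim_coord_neq0 h u : rim_coord h u != 0 -> exists2 i, u = c1 i & h (c2 i) != 0.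
Proof.
have [[i ->]|nu] := pselect (exists i, u = c1 i).
  by rewrite rim_coordE; exists i.
by rewrite rim_coord_out ?eqxx// => i; apply/eqP => e; apply: nu; exists i.
Qed.

Lemma glue_sum (F : V1 -> R) (G : V2 -> R) :
  \sum_(s : glue_vertex) (match s with inl u => F (val u) | inr w => G (val w) end) =
  \sum_(u | u != v1) F u + \sum_(w in off_star2) G w.
Proof.
by rewrite big_sumType /= -(big_sub _ F) -(big_sub _ G).
Qed.

Lemma sum_star2 (h : V2 -> R) :
  \sum_w h w = h v2 + (\sum_i h (c2 i) + \sum_(w in off_star2) h w).
Proof.
case: star2 => ci cv _ _ _.
rewrite (bigD1 v2)//= (bigID (fun w => w \in codom c2)) /=; congr (_ + (_ + _)).
rewrite (eq_bigl (fun w => w \in c2 @: 'I_6)) ?big_imset//=.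
  by move=> i k _ _; exact: ci.
move=> w; apply/andP/imsetP => [[_ /codomP[i ->]]|[i _ ->]]; first by exists i.
by rewrite cv codom_f.
Qed.

Lemma left_geometric x : barycentric adj1 x -> x v1 = 0 ->
  barycentric glue_adj (left_coord x).
Proof.
move=> [x0 x1 xK] xv; split.
- by case=> [u|w] /=.
- rewrite (glue_sum x (fun=> 0)) [X in _ + X]big1// addr0.
  by rewrite -x1 [RHS](bigD1 v1)//= xv add0r.
- by move=> [u|w] [u'|w'] //=; rewrite ?eqxx//; exact: xK.
Qed.

(** Two rim vertices inherit their adjacency from the left summand. It agrees with [adj2] because
    both hexagons are induced and listed in the same cyclic order. *)
Lemma right_geometric h : barycentric adj2 h -> h v2 = 0 ->
  barycentric glue_adj (right_coord h).
Proof.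
case: (star1) => ci1 cv1 _ _ cc1; case: (star2) => ci2 cv2 _ _ cc2.
move=> [h0 h1 hK] hv; split.
- move=> [u|w] //=; apply: sumr_ge0 => i _; exact: mulr_ge0.
- rewrite glue_sum -h1 sum_star2 hv add0r; congr (_ + _).
  rewrite exchange_big /=; apply: eq_bigr => i _.
  rewrite (bigD1 (c1 i))//= eqxx mul1r big1 ?addr0// => u /andP[_ ui].
  by rewrite eq_sym (negPf ui) mul0r.
- move=> [u|w] [u'|w'] /=.
  + move=> /rim_coord_neq0[i ui hi] /rim_coord_neq0[k uk hk] uu'.
    have ik : i != k.
      apply: contraNneq uu' => ik; apply/eqP; congr inl; apply: val_inj.
      by rewrite /= ui uk ik.
    by rewrite ui uk cc1// -cc2//; apply: hK; rewrite ?(inj_eq ci2).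
  + move=> /rim_coord_neq0[i ui hi] hw _; apply/existsP; exists i.
    rewrite ui eqxx hK//; have := svalP w'; apply: contraTneq => <-.
    by rewrite inE codom_f andbF.
  + move=> hw /rim_coord_neq0[i ui hi] _; apply/existsP; exists i.
    rewrite ui eqxx hK//; have := svalP w; apply: contraTneq => ->.
    by rewrite inE codom_f andbF.
  + by move=> hw hw' ww'; apply: hK => //; apply: contraNneq ww' => /val_inj ->.
Qed.

Lemma left_coord_inj x x' : x v1 = 0 -> x' v1 = 0 ->
  left_coord x =1 left_coord x' -> x =1 x'.
Proof.
move=> xv xv' e u; have [->|uv] := eqVneq u v1; first by rewrite xv xv'.
by have := e (inl (exist _ u uv)).
Qed.

Lemma right_coord_inj h h' : h v2 = 0 -> h' v2 = 0 ->
  right_coord h =1 right_coord h' -> h =1 h'.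
Proof.
case: (star1) => ci1 cv1 _ _ cc1.
move=> hv hv' e w; have [->|wv] := eqVneq w v2; first by rewrite hv hv'.
have [/codomP[i ->]|wc] := boolP (w \in codom c2).
  have cv : c1 i \in predC1 v1 by rewrite inE.
  by have := e (inl (exist _ (c1 i) cv)); rewrite /= !rim_coordE.
have wo : w \in off_star2 by rewrite inE wv.
by have := e (inr (exist _ w wo)).
Qed.

(** This shows that the overlap of the two sides is just the hexagon, so that only boundary points
    of the discs get identified. *)
Lemma left_right_coord x h : x v1 = 0 -> h v2 = 0 ->
  left_coord x =1 right_coord h ->
  (forall w, w \notin codom c2 -> h w = 0) /\ x =1 rim_coord h.
Proof.
case: (star1) => ci1 cv1 _ _ cc1 xv hv e; split=> [w wc|u].
  have [->//|wv] := eqVneq w v2.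
  have wo : w \in off_star2 by rewrite inE wv.
  by have := e (inr (exist _ w wo)).
have [->|uv] := eqVneq u v1.
  by rewrite xv rim_coord_out// => i; rewrite eq_sym.
by have := e (inl (exist _ u uv)).
Qed.

(** If a right vertex is in the support, every left support vertex is adjacent to it and therefore
    on the rim, so the point comes from the right. Otherwise it comes from the left. *)
Lemma glue_coord_surj z : barycentric glue_adj z ->
  (exists x, [/\ barycentric adj1 x, x v1 = 0 & left_coord x =1 z]) \/
  (exists h, [/\ barycentric adj2 h, h v2 = 0 & right_coord h =1 z]).
Proof.
case: (star1) => ci1 cv1 _ _ cc1; case: (star2) => ci2 cv2 _ _ cc2.
move=> [z0 z1 zK].
have [[w zw]|noright] := pselect (exists w, z (inr w) != 0); [right|left].
  have rim u : z (inl u) != 0 -> exists i, val u = c1 i.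
    move=> zu; have := zK _ _ zu zw isT.
    by move=> /existsP[i /andP[/eqP <- _]]; exists i.
  have cP i : c1 i \in predC1 v1 by rewrite inE.
  (* At [v2] the subtype test fails and no indicator fires, so the value is 0 as required. *)
  pose h (w : V2) := if insub w is Some w' then z (inr w')
    else \sum_i (c2 i == w)%:R * z (inl (exist _ (c1 i) (cP i))).
  have hc i : h (c2 i) = z (inl (exist _ (c1 i) (cP i))).
    rewrite /h insubF; last by rewrite inE codom_f andbF.
    rewrite (bigD1 i)//= eqxx mul1r big1 ?addr0// => k ki.
    by rewrite (inj_eq ci2) (negPf ki) mul0r.
  have hw (w' : glue_right) : h (val w') = z (inr w') by rewrite /h valK.
  have hv : h v2 = 0.
    rewrite /h insubF; last by rewrite inE eqxx.
    by rewrite big1// => i _; rewrite (negPf (cv2 i)) mul0r.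
  have zh : right_coord h =1 z.
    case=> [u|w'] /=; last exact: hw.
    have [[i ui]|nu] := pselect (exists i, val u = c1 i).
      by rewrite ui rim_coordE hc; congr (z (inl _)); exact: val_inj.
    rewrite rim_coord_out => [|i]; last by apply/eqP => e; apply: nu; exists i.
    by apply/esym/eqP; apply: contra_notT nu => /rim.
  have cases w0 : h w0 != 0 ->
      (exists i, w0 = c2 i) \/ exists w' : glue_right, w0 = val w'.
    have [/codomP[i ->]|wc] := boolP (w0 \in codom c2); first by left; exists i.
    have [->|wv] := eqVneq w0 v2; first by rewrite hv eqxx.
    have wo : w0 \in off_star2 by rewrite inE wv.
    by right; exists (exist _ w0 wo).
  exists h; split=> //; split.
  - move=> w0; have [|] := boolP (h w0 != 0); last by rewrite negbK => /eqP ->.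
    by move=> /cases[[i ->]|[w' ->]]; rewrite ?hc ?hw.
  - rewrite sum_star2 hv add0r -z1 -(eq_bigr _ (fun s _ => zh s)) glue_sum.
    congr (_ + _); rewrite exchange_big /=; apply: eq_bigr => i _.
    rewrite (bigD1 (c1 i))//= eqxx mul1r big1 ?addr0// => u /andP[_ ui].
    by rewrite eq_sym (negPf ui) mul0r.
  - move=> a b ha hb; move: (ha) (hb) => /cases[[i ai]|[w' aw]] /cases[[k bk]|[w'' bw]];
      move: ha hb; rewrite ?ai ?aw ?bk ?bw ?hc ?hw => ha hb ab.
    + have ik : i != k by apply: contraNneq ab => ->.
      rewrite cc2// -cc1//; apply: (zK _ _ ha hb).
      by apply: contraNneq ik => -[/ci1 ->].
    + have /existsP[k /andP[/eqP/ci1 -> //]] := zK _ _ ha hb isT.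
    + have /existsP[l /andP[/eqP/ci1 -> //]] := zK _ _ ha hb isT.
    + by apply: (zK _ _ ha hb); apply: contraNneq ab => -[->].
have zr w : z (inr w) = 0.
  by apply/eqP; apply: contra_notT noright => zw; exists w.
pose x (u : V1) := if insub u is Some u' then z (inl u') else 0.
have xu (u : glue_left) : x (val u) = z (inl u) by rewrite /x valK.
have xv : x v1 = 0 by rewrite /x insubF// inE eqxx.
have zx : left_coord x =1 z by case=> [u|w] /=; rewrite ?xu ?zr.
have cases u : x u != 0 -> exists u' : glue_left, u = val u'.
  have [->|uv] := eqVneq u v1; first by rewrite xv eqxx.
  by exists (exist _ u uv).
exists x; split => //; split.
- by move=> u; rewrite /x; case: insub.
- rewrite (bigD1 v1)//= xv add0r -z1 -(eq_bigr _ (fun s _ => zx s)).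
  by rewrite (glue_sum x (fun=> 0)) [X in _ + X]big1// addr0.
- move=> a b ha hb; move: (ha) (hb) => /cases[a' ea] /cases[b' eb]; rewrite ea eb => ab.
  apply: (zK (inl a') (inl b')); rewrite -?xu -?ea -?eb//.
Qed.

End coordinates.
End gluing.

(** * The glued complex realizes the connected sum *)

Section glue_spaces.
Variables (R : realType) (V1 V2 : finType) (adj1 : rel V1) (adj2 : rel V2).
Variables (v1 : V1) (c1 : 'I_6 -> V1) (v2 : V2) (c2 : 'I_6 -> V2).
Hypothesis star1 : hex_star adj1 v1 c1.
Hypothesis star2 : hex_star adj2 v2 c2.
Let X1 := realization R (clique_complex adj1).
Let X2 := realization R (clique_complex adj2).
Variables (M : topologicalType) (phi : X2 -> M) (psi : M -> X2).
Hypotheses (phiK : cancel phi psi) (psiK : cancel psi phi).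
Hypotheses (phi_cont : continuous phi) (psi_cont : continuous psi).
Hypotheses (cX1 : compact [set: X1]) (cX2 : compact [set: X2]).

Let gadj := @glue_adj V1 V2 adj1 adj2 v1 c1 v2 c2.
Let X := realization R (clique_complex gadj).

Let e1 : disc R -> X1 := star_emb star1.
(** The connected sum is taken with [M] itself, which is only homeomorphic to the realization [X2];
    the disc is carried over by [phi]. *)
Let e2 : disc R -> M := phi \o star_emb star2.

Lemma glue_e2_embedding : embedding e2.
Proof.
apply: compact_hausdorff_embedding.
- move=> d; apply: continuous_comp; [exact: star_emb_continuous|exact: phi_cont].
- by move=> d d' /(can_inj phiK); exact: star_emb_inj.
- exact: disc_compact.
- exact: hausdorff_inj psi_cont (can_inj psiK) (@realization_hausdorff _ _ _).
Qed.

Lemma punctured_l0 (p : punctured_l e1) : bary (val p) v1 = 0.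
Proof.
apply/eqP; apply: contraT => pv; have := set_valP p; case.
have : [set x : X1 | bary x v1 != 0] (val p) by [].
by rewrite -(star_emb_interior _ star1) => -[d d1 ed]; exists d.
Qed.

Lemma punctured_r0 (q : punctured_r e2) : bary (psi (val q)) v2 = 0.
Proof.
apply/eqP; apply: contraT => qv; have := set_valP q; case.
have : [set x : X2 | bary x v2 != 0] (psi (val q)) by [].
rewrite -(star_emb_interior _ star2) => -[d d1 ed]; exists d => //.
by rewrite /e2 /= ed psiK.
Qed.

Definition glue_l (p : punctured_l e1) : X :=
  bary_point (left_geometric adj2 c1 v2 c2 (baryP (val p)) (punctured_l0 p)).

Definition glue_r (q : punctured_r e2) : X :=
  bary_point (right_geometric star1 star2 (baryP (psi (val q))) (punctured_r0 q)).

Definition glue_map (a : {b : bool & pieces e1 e2 b}) : X :=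
  (if projT1 a as b return pieces e1 e2 b -> X then glue_l else glue_r) (projT2 a).

Lemma glue_map_continuous : continuous glue_map.
Proof.
have vl : continuous (val : punctured_l e1 -> X1) by exact: val_continuous.
have vr : continuous (psi \o (val : punctured_r e2 -> M)).
  by move=> q; apply: continuous_comp; [exact: val_continuous|exact: psi_cont].
apply: (@sigT_continuous _ (pieces e1 e2) _
  (fun b => if b return pieces e1 e2 b -> X then glue_l else glue_r)) => -[];
  apply: to_realization_continuous => -[u|w].
- have h := @bary_continuous R V1 adj1 (val u).
  by move=> p; apply: (continuous_comp (vl p) (h _)).
- exact: cont_cst.
- apply: cont_sum => i; apply: contM; first exact: cont_cst.
  have h := @bary_continuous R V2 adj2 (c2 i).
  by move=> p; apply: (continuous_comp (vr p) (h _)).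
- have h := @bary_continuous R V2 adj2 (val w).
  by move=> p; apply: (continuous_comp (vr p) (h _)).
Qed.

Lemma glue_map_surj x : exists a, glue_map a = x.
Proof.
have [[y [gy yv ey]]|[h [gh hv eh]]] := glue_coord_surj star1 star2 (baryP x).
- have py : (~` (e1 @` @open_disc R)) (bary_point gy).
    by rewrite /e1 (star_emb_interior _ star1) /= bary_pointK yv eqxx.
  exists (existT (pieces e1 e2) true (SigSub (mem_set py))).
  by apply: bary_inj => s; rewrite -ey.
- have ph : (~` (e2 @` @open_disc R)) (phi (bary_point gh)).
    move=> [d d1 /(can_inj phiK) ed].
    have : (star_emb star2 @` @open_disc R) (bary_point gh) by exists d.
    by rewrite (star_emb_interior _ star2) /= bary_pointK hv eqxx.
  exists (existT (pieces e1 e2) false (SigSub (mem_set ph))).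
  by apply: bary_inj => s; rewrite -eh /= bary_pointK /= phiK.
Qed.

(** The common image has all its weight on the rim. Seen from the right it is thus a point of the
    closed star with apex weight 0, that is a boundary point [d] of the disc, and the same [d]
    parametrizes it on the left. *)
Lemma glue_map_lr (p : punctured_l e1) (q : punctured_r e2) :
  glue_l p = glue_r q -> glued (existT (pieces e1 e2) true p) (existT (pieces e1 e2) false q).
Proof.
move=> /(congr1 (@bary _ _ _)); rewrite !bary_pointK => e.
have [h0 xh] := left_right_coord star1 (punctured_l0 p) (punctured_r0 q) (fun s => congr1 (@^~ s) e).
have [w wv wc|d dq] := star_emb_surj star2 (x := psi (val q)).
  apply: h0; apply/negP => /codomP[i wi]; by move: (wc i); rewrite wi eqxx.
have d1 : sqnorm (val d) = 1.
  by apply/eqP; rewrite -(star_emb_boundary star2) dq punctured_r0.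
apply: (Glued d1); last by rewrite /e2 /= dq psiK.
apply: bary_inj => u; rewrite [LHS]xh /rim_coord -dq.
have dA : disc_apex (val d ord0 ord0) (val d ord0 ord_max) = 0.
  by apply/eqP; rewrite disc_apex_eq0 ?disc_le1// -sqnorm2 d1.
rewrite [RHS]star_embE [RHS]/star_point dA mul0r add0r.
by apply: eq_bigr => i _; rewrite star_embE (star_point_rim star2) mulrC.
Qed.

Lemma glued_glue_map a b : glued a b -> glue_map a = glue_map b.
Proof.
case=> d p q d1 pd qd; apply: bary_inj => s.
rewrite /glue_map /= /glue_l /glue_r !bary_pointK.
have dA : disc_apex (val d ord0 ord0) (val d ord0 ord_max) = 0.
  by apply/eqP; rewrite disc_apex_eq0 ?disc_le1// -sqnorm2 d1.
have -> : psi (val q) = star_emb star2 d.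
  by rewrite -[RHS]phiK; congr psi; exact: qd.
have -> : val p = star_emb star1 d by exact: pd.
case: s => [u|w] /=.
  rewrite star_embE [LHS]/star_point dA mul0r add0r.
  by apply: eq_bigr => i _; rewrite star_embE (star_point_rim star2) mulrC.
have := svalP w; rewrite inE => /andP[wv wc].
rewrite star_embE (star_point_out _ wv)// => i; apply: contraNneq wc => ->.
exact: codom_f.
Qed.

Lemma glue_map_kernel a b : glue_map a = glue_map b <-> glue_rel a b.
Proof.
split=> [|/asboolP]; last first.
  elim=> [x y /glued_glue_map//|//|x y _ //|x y z _ -> _ ->//].
case: a b => [[] p] [[] q] /= e; apply/asboolP.
- have -> : p = q; last exact: rst_refl.
  apply: val_inj; apply: bary_inj.
  apply: left_coord_inj; [exact: punctured_l0|exact: punctured_l0|] => s.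
  by have := congr1 (fun x : X => bary x s) e.
- by apply: rst_step; exact: glue_map_lr.
- by apply: rst_sym; apply: rst_step; exact: glue_map_lr.
- have -> : p = q; last exact: rst_refl.
  apply: val_inj; apply: (can_inj psiK); apply: bary_inj.
  apply: (right_coord_inj star1); [exact: punctured_r0|exact: punctured_r0|] => s.
  by have := congr1 (fun x : X => bary x s) e.
Qed.

(** The removed sets are open, being the loci where the coordinate at the centre is nonzero; so the
    pieces are closed in compact spaces. *)
Lemma glue_domain_compact : compact [set: {b : bool & pieces e1 e2 b}].
Proof.
have co1 : open (e1 @` @open_disc R).
  rewrite /e1 (star_emb_interior _ star1).
  apply: (@open_comp _ _ (fun x : X1 => bary x v1) [set t | t != 0]) => [x _|].
    exact: bary_continuous.
  exact: open_neq.
have co2 : open (e2 @` @open_disc R).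
  rewrite (_ : _ @` _ = (fun m => bary (psi m) v2) @^-1` [set t | t != 0]).
    apply: open_comp => [m _|]; last exact: open_neq.
    have h := @bary_continuous R V2 adj2 v2.
    by apply: (@continuous_comp M X2 R psi (fun x : X2 => bary x v2) m); [exact: psi_cont|exact: h].
  rewrite /e2 -image_comp (star_emb_interior _ star2).
  apply/seteqP; split => [_ [x xv <-]|m mv] /=; first by rewrite phiK.
  by exists (psi m) => //; rewrite psiK.
apply: sigT_compact => [|[]].
- exact: finite_finset.
- by apply: closed_set_type_compact => //; rewrite closedC.
- apply: closed_set_type_compact; last by rewrite closedC.
  by apply: (compact_surj phi_cont) cX2 => m; exists (psi m).
Qed.

Lemma glue_connected_sum :
  is_connected_sum R X1 M X /\ compact [set: X].
Proof.
split; last first.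
  exact: compact_surj glue_map_continuous glue_map_surj glue_domain_compact.
exists e1, e2; split; [exact: star_emb_embedding|exact: glue_e2_embedding|].
apply: homeomorphic_of_quotient_maps.
- exact: pi_quotient_map.
- apply: compact_hausdorff_quotient_map.
  + exact: glue_map_continuous.
  + exact: glue_map_surj.
  + exact: glue_domain_compact.
  + exact: realization_hausdorff.
- move=> a b; rewrite glue_map_kernel; split=> [/eqmodP//|ab].
  by apply/eqmodP.
Qed.

End glue_spaces.

(** * Survival of a second hexagonal star under gluing *)

Section glue_star.
Variables (V1 V2 : finType) (adj1 : rel V1) (adj2 : rel V2).
Variables (v1 : V1) (c1 : 'I_6 -> V1) (v2 : V2) (c2 : 'I_6 -> V2).
Hypothesis star1 : hex_star adj1 v1 c1.
Hypothesis star2 : hex_star adj2 v2 c2.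
Variables (v : V2) (d : 'I_6 -> V2).
Hypothesis star : hex_star adj2 v d.
Hypotheses (vv2 : v != v2) (nadj : ~~ adj2 v v2) (nadj' : ~~ adj2 v2 v).

Let gadj := @glue_adj V1 V2 adj1 adj2 v1 c1 v2 c2.

Lemma rim_left i : c1 i \in predC1 v1.
Proof. by case: star1 => _ cv _ _ _; rewrite inE. Qed.

Definition left_rim i : glue_left v1 :=
  exist (fun u => u \in predC1 v1) (c1 i) (rim_left i).

(** The deleted vertex [v2] receives a dummy rim vertex; the lemmas below exclude it. *)
Definition glue_emb (w : V2) : glue_vertex v1 v2 c2 :=
  if insub w is Some w' then inr w'
  else inl (left_rim (odflt ord0 [pick k | c2 k == w])).

Lemma glue_emb_rim k : glue_emb (c2 k) = inl (left_rim k).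
Proof.
case: star2 => ci _ _ _ _; rewrite /glue_emb insubF; last first.
  by rewrite inE codom_f andbF.
congr inl; apply: val_inj => /=; case: pickP => [l /eqP/ci -> //|/(_ k)].
by rewrite eqxx.
Qed.

Lemma glue_emb_off w (wo : w \in off_star2 v2 c2) :
  glue_emb w = inr (exist (fun w => w \in off_star2 v2 c2) w wo).
Proof. by rewrite /glue_emb insubT. Qed.

Lemma rim_or_off w : w != v2 -> (exists k, w = c2 k) \/ w \in off_star2 v2 c2.
Proof.
move=> wv; have [/codomP[k ->]|wc] := boolP (w \in codom c2).
  by left; exists k.
by right; rewrite inE wv.
Qed.

Lemma glue_emb_adj w w' : w != v2 -> w' != v2 -> w != w' ->
  gadj (glue_emb w) (glue_emb w') = adj2 w w'.
Proof.
case: (star1) => ci1 _ _ _ cc1; case: (star2) => ci2 _ _ _ cc2.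
move=> /rim_or_off[[k ->]|wo] /rim_or_off[[k' ->]|wo'] ww'.
- rewrite !glue_emb_rim /gadj /=.
  have kk : k != k' by apply: contraNneq ww' => ->.
  by rewrite cc1// cc2.
- rewrite glue_emb_rim glue_emb_off /gadj /=.
  apply/existsP/idP => [[i /andP[/eqP/ci1 -> //]]|h].
  by exists k; rewrite eqxx.
- rewrite glue_emb_rim glue_emb_off /gadj /=.
  apply/existsP/idP => [[i /andP[/eqP/ci1 -> //]]|h].
  by exists k'; rewrite eqxx.
- by rewrite !glue_emb_off.
Qed.

Lemma glue_emb_inj w w' : w != v2 -> w' != v2 -> glue_emb w = glue_emb w' -> w = w'.
Proof.
case: (star1) => ci1 _ _ _ _.
move=> /rim_or_off[[k ->]|wo] /rim_or_off[[k' ->]|wo'];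
  rewrite ?glue_emb_rim ?glue_emb_off//.
- by move=> [/ci1 ->].
- by move=> [].
Qed.

(** As [v] and [v2] are distinct and non-adjacent, [v] is off the rim and so gains no neighbour from
    the left; and no neighbour of [v] is the deleted [v2]. *)
Lemma glue_hex_star : hex_star gadj (glue_emb v) (glue_emb \o d).
Proof.
case: (star1) => ci1 _ _ _ _; case: (star) => di dv vout vd dd.
case: (star2) => _ _ _ vc2 _.
have dv2 i : d i != v2.
  by apply: contraNneq nadj => <-; apply: (vd i).1.
have vo : v \in off_star2 v2 c2.
  case: (rim_or_off vv2) => // -[k vk].
  by move: nadj'; rewrite vk (vc2 k).1.
split.
- by move=> i k /= /glue_emb_inj /di; apply.
- by move=> i /=; apply: contraNneq (dv i) => /glue_emb_inj ->.
- rewrite glue_emb_off => -[u|w]; rewrite /gadj /=; split.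
  + move=> /existsP[k /andP[/eqP ku /(vout _).1[i ki]]]; exists i.
    by rewrite -ki glue_emb_rim; congr inl; apply: val_inj.
  + move=> /existsP[k /andP[/eqP ku /(vout _).2[i ki]]]; exists i.
    by rewrite -ki glue_emb_rim; congr inl; apply: val_inj.
  + move=> /(vout _).1[i wi]; exists i; rewrite -wi glue_emb_off ?(svalP w)// => wo.
    by congr inr; apply: val_inj.
  + move=> /(vout _).2[i wi]; exists i; rewrite -wi glue_emb_off ?(svalP w)// => wo.
    by congr inr; apply: val_inj.
- by move=> i /=; rewrite !glue_emb_adj// 1?eq_sym//; apply: vd.
- by move=> i k ik /=; rewrite glue_emb_adj ?(inj_eq di)// dd.
Qed.

End glue_star.

(** In an iterated sum, [v] is glued to the previous summand, and [w] is kept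
    for the next one. *)
Definition summand (R : realType) (M : topologicalType) (V : finType)
    (adj : rel V) (v w : V) (c d : 'I_6 -> V) : Prop :=
  [/\ hex_star adj v c, hex_star adj w d,
      [/\ w != v, ~~ adj w v & ~~ adj v w],
      compact [set: realization R (clique_complex adj)]
    & homeomorphic (realization R (clique_complex adj)) M].

Lemma iterated_sum_triangulation (R : realType) (M : topologicalType) (V : finType)
    (adj : rel V) (v w : V) (c d : 'I_6 -> V) (m k : nat) :
  summand R M adj v w c d -> #|V| = (8 + m)%N -> (1 <= k)%N ->
  exists (W : finType) (L : {set {set W}}),
    is_flag_triangulation R (is_iterated_connected_sum R M k) L /\
    (#|W| <= 8 + m * k)%N.
Proof.
move=> [sv sw [wv nwv nvw] cX [phi [psi [phiK psiK phic psic]]]] cardV.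
(* The induction also carries compactness of the realization and a free hexagonal star, both of
   which the next gluing requires. *)
suff H j : exists (W : finType) (b : rel W) (u : W) (e : 'I_6 -> W),
    [/\ hex_star b u e, compact [set: realization R (clique_complex b)],
        is_iterated_connected_sum R M j.+1 (realization R (clique_complex b))
      & (#|W| = 8 + m * j.+1)%N].
  case: k => // j _; have [W [b [u [e [_ _ S cW]]]]] := H j.
  exists W, (clique_complex b); split; last by rewrite cW.
  split; [exact: clique_complex_simplicial|exact: clique_complex_flag|].
  by exists (realization R (clique_complex b)) => //; exact: homeomorphic_refl.
elim: j => [|j [W [b [u [e [se cW S card]]]]]].
  exists V, adj, v, c; split => //; last by rewrite muln1.
  by apply: ICS_one; exists psi, phi; split.
have [cs cW'] := glue_connected_sum se sv phiK psiK phic psic cW cX.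
exists (glue_vertex u v c), (@glue_adj W V b adj u e v c).
do 2!eexists; split.
- exact: (glue_hex_star se sv sw wv nwv nvw).
- exact: cW'.
- exact: ICS_add S cs.
- have := glue_vertex_card u sv; rewrite card cardV; lia.
Qed.

Lemma summand_bounds (R : realType) (M : topologicalType) (V : finType)
    (adj : rel V) (v w : V) (c d : 'I_6 -> V) (m k : nat) :
  summand R M adj v w c d -> #|V| = (8 + m)%N -> (1 <= k)%N ->
  (exists (W : finType) (L : {set {set W}}),
    is_flag_triangulation R (is_iterated_connected_sum R M k) L /\
    (#|W| <= 8 + m * k)%N) /\
  (forall (W : finType) (L : {set {set W}}),
    is_vertex_minimal_flag_triangulation R (is_iterated_connected_sum R M k) L ->
    (#|W| <= 8 + m * k)%N).
Proof.
move=> sm cardV k1; have H := iterated_sum_triangulation sm cardV k1; split => //.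
move=> W L [_ minL]; have [W' [L' [tL' cW']]] := H.
exact: leq_trans (minL _ _ tL') cW'.
Qed.

(** * The torus *)

(** Turns the star condition into boolean tests, so that concrete stars are settled by
    enumeration. *)
Lemma hex_star_of_seq (V : finType) (adj : rel V) (v : V) (s : seq V) :
  size s = 6%N -> uniq (v :: s) ->
  (forall w, (adj v w = (w \in s)) * (adj w v = (w \in s))) ->
  (forall i k : 'I_6, i != k -> adj (nth v s i) (nth v s k) = hex_adj i k) ->
  hex_star adj v (fun i => nth v s i).
Proof.
move=> ss /= /andP[vs us] adjv adjs.
have mem_s w : w \in s -> exists i : 'I_6, w = nth v s i.
  move=> ws; have lt6 : (index w s < 6)%N by rewrite -ss index_mem.
  by exists (Ordinal lt6); rewrite /= nth_index.
have s_mem (i : 'I_6) : nth v s i \in s by rewrite mem_nth// ss.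
split=> //.
- by move=> i k /= /eqP; rewrite nth_uniq ?ss// => /eqP/val_inj.
- by move=> i; apply: contraNneq vs => <-.
- by move=> w; rewrite !adjv; split; exact: mem_s.
- by move=> i; rewrite !adjv.
Qed.

(** The product of a square and a hexagon, triangulated by diagonals that all
    start in row [false], has 24 vertices; this is the adjacency in its quotient by
    the antipodal map, which shifts the hexagon by 3. *)
Definition torus_adj (s t : bool * 'I_6) : bool :=
  if s.1 == t.1 then hex_adj s.2 t.2
  else (if s.1 then s.2 - t.2 else t.2 - s.2) \in [:: 0; 1; 3; 4].

Definition o6 (n : nat) : 'I_6 := inZp n.

Lemma torus_star0 : hex_star torus_adj (false, 0) (fun i => nth (false, 0)
  [:: (false, 1); (true, 1); (true, 0); (false, o6 5); (true, o6 3); (true, o6 4)] i).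
Proof.
apply: hex_star_of_seq => //.
- by move=> [[] i]; elim/ord6_ind: i.
- by move=> i k; elim/ord6_ind: i; elim/ord6_ind: k.
Qed.

Lemma torus_star1 : hex_star torus_adj (true, o6 2) (fun i => nth (true, o6 2)
  [:: (true, o6 3); (false, o6 2); (false, 1); (true, 1); (false, o6 4); (false, o6 5)] i).
Proof.
apply: hex_star_of_seq => //.
- by move=> [[] i]; elim/ord6_ind: i.
- by move=> i k; elim/ord6_ind: i; elim/ord6_ind: k.
Qed.

(** * Coordinates on the triangulated prisms *)

Section torus_coord.
Variable R : realType.
Implicit Types (X Y : R) (K : 'I_6 -> R).

Definition posmin (a b : R) : R := rpos (Num.min a b).

(** The barycentric coordinates of the image of the point [(X, Y)] of the square
    and the point [K] of the hexagon.  The rows are the axes of the square: a vertex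
    of row [false] lies over [X = 1] or, shifted by 3, over [X = -1]. *)
Definition torus_coord X Y K (s : bool * 'I_6) : R :=
  let i := s.2 in
  if s.1 then posmin (K i) (rpos Y - K (i + 1)) +
              posmin (K (i + 3)) (rpos (- Y) - K (i + 4))
  else posmin (K i) (rpos X - K (i - 1)) +
       posmin (K (i + 3)) (rpos (- X) - K (i + 2)).

Lemma torus_coordN X Y K s :
  torus_coord (- X) (- Y) (fun i => K (i + 3)) s = torus_coord X Y K s.
Proof.
case: s => r i; rewrite /torus_coord /= !opprK.
have -> : i - 1 + 3 = i + 2 by elim/ord6_ind: i; apply: val_inj.
have -> : i + 1 + 3 = i + 4 by elim/ord6_ind: i; apply: val_inj.
have -> : i + 3 + 3 = i by elim/ord6_ind: i; apply: val_inj.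
have -> : i + 2 + 3 = i - 1 by elim/ord6_ind: i; apply: val_inj.
have -> : i + 4 + 3 = i + 1 by elim/ord6_ind: i; apply: val_inj.
by case: r; rewrite addrC.
Qed.

Lemma posmin0 (a b : R) : b <= 0 -> posmin a b = 0.
Proof. by move=> b0; rewrite /posmin rpos0// ge_min b0 orbT. Qed.

(** Weights on one square of a prism: the edge from [j] to [j + 1] in row [false], and the same edge
    displaced by [d] in row [true]. The shift [d] is 0 over [Y >= 0] and 3 over [Y < 0]. *)
Definition torus_shape (d j : 'I_6) (a0 b0 a1 b1 : R) (s : bool * 'I_6) : R :=
  if s.1 then edge_coord j a1 b1 (s.2 + d) else edge_coord j a0 b0 s.2.

Lemma edge_coordj j (a b : R) : edge_coord j a b j = a.
Proof.
rewrite /edge_coord eqxx mulr1 (_ : j == j + 1 = false) ?mulr0 ?addr0//.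
by elim/ord6_ind: j.
Qed.

Lemma edge_coordj1 j (a b : R) : edge_coord j a b (j + 1) = b.
Proof.
rewrite /edge_coord eqxx mulr1 (_ : j + 1 == j = false) ?mulr0 ?add0r//.
by elim/ord6_ind: j.
Qed.

Lemma edge_coord_out j (a b : R) i : i != j -> i != j + 1 -> edge_coord j a b i = 0.
Proof. by move=> /negPf ij /negPf ij1; rewrite /edge_coord ij ij1 !mulr0 addr0. Qed.

Lemma edgeP (j i : 'I_6) : [\/ i = j, i = j + 1 | (i != j) && (i != j + 1)].
Proof.
have [->|ij] := eqVneq i j; first exact: Or31.
have [->|ij1] := eqVneq i (j + 1); first exact: Or32.
exact: Or33.
Qed.

(** Subtracting the weight at [i - 1] fills [j] up to [a] before anything overflows to [j + 1]. Row
    [true] is filled in the opposite order, so the diagonal joins [j] in row [false] to [j + 1] in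
    row [true]. *)
Lemma prism_row0 X j (a b : R) i : 0 <= X -> X <= 1 -> 0 <= a -> 0 <= b -> a + b = 1 ->
  posmin (edge_coord j a b i) (X - edge_coord j a b (i - 1)) =
  edge_coord j (Num.min a X) (rpos (X - a)) i.
Proof.
move=> X0 X1 a0 b0 ab.
have [->|->|/andP[ij ij1]] := edgeP j i.
- rewrite !edge_coordj edge_coord_out; first by rewrite subr0 /posmin rposE// le_min a0 X0.
  + by elim/ord6_ind: j.
  + by elim/ord6_ind: j.
- rewrite addrK !edge_coordj1 edge_coordj /posmin min_r//; lra.
- rewrite ![edge_coord _ _ _ i]edge_coord_out// /posmin rpos0// ge_min lexx//.
Qed.

Lemma prism_row1 Y j (a b : R) i : 0 <= Y -> Y <= 1 -> 0 <= a -> 0 <= b -> a + b = 1 ->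
  posmin (edge_coord j a b i) (Y - edge_coord j a b (i + 1)) =
  edge_coord j (rpos (Y - b)) (Num.min b Y) i.
Proof.
move=> Y0 Y1 a0 b0 ab.
have [->|->|/andP[ij ij1]] := edgeP j i.
- rewrite !edge_coordj edge_coordj1 /posmin min_r//; lra.
- rewrite !edge_coordj1 edge_coord_out; first by rewrite subr0 /posmin rposE// le_min b0 Y0.
  + by elim/ord6_ind: j.
  + by elim/ord6_ind: j.
- rewrite ![edge_coord _ _ _ i]edge_coord_out// /posmin rpos0// ge_min lexx//.
Qed.

Lemma torus_coord_shape X Y j (a b : R) : 0 <= X -> X + `|Y| = 1 ->
  0 <= a -> 0 <= b -> a + b = 1 ->
  torus_coord X Y (edge_coord j a b) =1
  torus_shape (if 0 <= Y then 0 else 3) j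
    (Num.min a X) (rpos (X - a)) (rpos (a - X)) (Num.min b `|Y|).
Proof.
move=> X0 XY a0 b0 ab [r i]; have K0 k := edge_coord_ge0 j k a0 b0.
have Y0 := normr_ge0 Y.
(* The overflows of the two rows have opposite signs, so at most one is positive: the point lies on
   one side of the diagonal. *)
have aX : a - X = `|Y| - b by lra.
rewrite /torus_coord /torus_shape aX /=; case: r; last first.
  rewrite (rposE X0) prism_row0//; last lra.
  by rewrite posmin0 ?addr0// rpos0 ?oppr_le0// sub0r oppr_le0.
have [Yge|Ylt] := leP 0 Y.
  rewrite (ger0_norm Yge) (rposE Yge) addr0 prism_row1//; last by rewrite -(ger0_norm Yge); lra.
  by rewrite posmin0 ?addr0// rpos0 ?oppr_le0// sub0r oppr_le0.
rewrite (ltr0_norm Ylt) posmin0 ?add0r; last first.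
  by rewrite rpos0 ?(ltW Ylt)// sub0r oppr_le0.
have -> : i + 4 = i + 3 + 1 by elim/ord6_ind: i; apply: val_inj.
rewrite rposE ?oppr_ge0 ?(ltW Ylt)// prism_row1//; first by rewrite oppr_ge0 ltW.
by rewrite -(ltr0_norm Ylt); lra.
Qed.

End torus_coord.

(** * The torus coordinates: values, fibres and surjectivity *)

Section torus_complex.
Variable R : realType.
Implicit Types (X Y : R) (K : 'I_6 -> R).

Lemma sum_edge1 j (a b : R) : \sum_i edge_coord j a b i = a + b.
Proof.
have := sum_edge_coord j a b (fun=> 1); rewrite !mulr1 => <-.
by apply: eq_bigr => i _; rewrite mulr1.
Qed.

Lemma sum_bool_ord (F : bool * 'I_6 -> R) :
  \sum_s F s = \sum_i F (false, i) + \sum_i F (true, i).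
Proof.
rewrite (eq_bigr (fun s => F (s.1, s.2))) => [|[]//].
by rewrite -(pair_bigA _ (fun r i => F (r, i))) /= big_bool /= addrC.
Qed.

Lemma sum_shape_row0 d j (a0 b0 a1 b1 : R) :
  \sum_i torus_shape d j a0 b0 a1 b1 (false, i) = a0 + b0.
Proof. exact: sum_edge1. Qed.

Lemma sum_shape_row1 d j (a0 b0 a1 b1 : R) :
  \sum_i torus_shape d j a0 b0 a1 b1 (true, i) = a1 + b1.
Proof.
rewrite -(sum_edge1 j a1 b1) [RHS](reindex_inj (addIr d)).
by apply: eq_bigr.
Qed.

Lemma edge_coord_neq0 j (a b : R) i : edge_coord j a b i != 0 ->
  (i = j /\ a != 0) \/ (i = j + 1 /\ b != 0).
Proof.
have [->|->|/andP[ij ij1]] := edgeP j i.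
- by rewrite edge_coordj; left.
- by rewrite edge_coordj1; right.
- by rewrite edge_coord_out// eqxx.
Qed.

(** The condition [b0 * a1 = 0] rules out the one pair of corners of the square that is not an
    edge. *)
Lemma torus_shape_barycentric d j (a0 b0 a1 b1 : R) : d \in [:: 0; 3] ->
  0 <= a0 -> 0 <= b0 -> 0 <= a1 -> 0 <= b1 -> a0 + b0 + (a1 + b1) = 1 ->
  b0 * a1 = 0 -> barycentric torus_adj (torus_shape d j a0 b0 a1 b1).
Proof.
move=> d03 a00 b00 a10 b10 s1 ba; split.
- by move=> [[] i]; exact: edge_coord_ge0.
- by rewrite sum_bool_ord sum_shape_row0 sum_shape_row1.
have cross i k : edge_coord j a0 b0 i != 0 -> edge_coord j a1 b1 (k + d) != 0 ->
    k - i \in [:: 0; 1; 3; 4].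
  move=> /edge_coord_neq0[[-> a0n]|[-> b0n]] /edge_coord_neq0[[kd a1n]|[kd b1n]].
  + have -> : k = j - d by rewrite -kd addrK.
    by move: d03; rewrite !inE => /orP[]/eqP ->; elim/ord6_ind: {+}j.
  + have -> : k = j + 1 - d by rewrite -kd addrK.
    by move: d03; rewrite !inE => /orP[]/eqP ->; elim/ord6_ind: {+}j.
  + by move/eqP: ba; rewrite mulf_eq0 (negPf b0n) (negPf a1n).
  + have -> : k = j + 1 - d by rewrite -kd addrK.
    by move: d03; rewrite !inE => /orP[]/eqP ->; elim/ord6_ind: {+}j.
move=> [[] i] [[] k]; rewrite /torus_shape /torus_adj /= => h1 h2 ik.
- have := edge_coord_adj h1 h2; rewrite (inj_eq (addIr d)).
  have -> : (i != k) by apply: contraNneq ik => ->.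
  by move=> /(_ isT); rewrite /hex_adj -!(addrAC _ 1) !(inj_eq (addIr d)).
- exact: cross h2 h1.
- exact: cross h1 h2.
- by apply: edge_coord_adj h1 h2 _; apply: contraNneq ik => ->.
Qed.

Definition torus_data X Y K : Prop :=
  `|X| + `|Y| = 1 /\ exists j a b, [/\ 0 <= a, 0 <= b, a + b = 1
    & K =1 edge_coord j a b].

Lemma torus_dataN X Y K : torus_data X Y K ->
  torus_data (- X) (- Y) (fun i => K (i + 3)).
Proof.
move=> [XY [j [a [b [a0 b0 ab e]]]]]; split; first by rewrite !normrN.
exists (j - 3), a, b; split => // i.
by rewrite e /edge_coord -(inj_eq (addIr 3) i) subrK -(inj_eq (addIr 3) i) addrAC subrK.
Qed.

Lemma eq_torus_coord X Y K K' : K =1 K' -> torus_coord X Y K =1 torus_coord X Y K'.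
Proof. by move=> e [[] i]; rewrite /torus_coord /= !e. Qed.

(** The weights can be inverted: row sums give back [X] and the absolute value of [Y], column sums
    give back [K]. Only the shift [d] has to be found separately. *)
Lemma torus_data_shape X Y K : 0 <= X -> torus_data X Y K ->
  exists d j a0 b0 a1 b1, [/\ torus_coord X Y K =1 torus_shape d j a0 b0 a1 b1,
    d = (if 0 <= Y then 0 else 3),
    [/\ 0 <= a0, 0 <= b0, 0 <= a1 & 0 <= b1],
    [/\ a0 + b0 = X, a1 + b1 = `|Y| & b0 * a1 = 0] &
    K =1 edge_coord j (a0 + a1) (b0 + b1)].
Proof.
move=> X0 [XY [j [a [b [a0 b0 ab e]]]]]; rewrite (ger0_norm X0) in XY.
exists (if 0 <= Y then 0 else 3), j, (Num.min a X), (rpos (X - a)),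
  (rpos (a - X)), (Num.min b `|Y|).
have Y0 := normr_ge0 Y.
split=> //.
- by move=> s; rewrite (eq_torus_coord _ _ e) torus_coord_shape.
- by split; rewrite ?rpos_ge0// le_min ?a0 ?X0 ?b0 ?Y0.
- have [aX|/ltW Xa] := leP a X.
    rewrite (@rposE _ (X - a)) ?subr_ge0// (@rpos0 _ (a - X)) ?subr_le0//.
    by rewrite (@min_r _ _ b); [split; lra|lra].
  rewrite (@rpos0 _ (X - a)) ?subr_le0// (@rposE _ (a - X)) ?subr_ge0//.
  by rewrite (@min_l _ _ b); [split; lra|lra].
- move=> i; rewrite e; congr (edge_coord _ _ _ _).
    have [aX|/ltW Xa] := leP a X.
      by rewrite (@rpos0 _ (a - X)) ?subr_le0// addr0.
    by rewrite (@rposE _ (a - X)) ?subr_ge0//; lra.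
  have [aX|/ltW Xa] := leP a X.
    by rewrite (@rposE _ (X - a)) ?subr_ge0// (@min_r _ _ b); lra.
  by rewrite (@rpos0 _ (X - a)) ?subr_le0// (@min_l _ _ b); lra.
Qed.

Lemma torus_coord_barycentric X Y K : torus_data X Y K ->
  barycentric torus_adj (torus_coord X Y K).
Proof.
wlog X0 : X Y K / 0 <= X => [wl dK|].
  have [/wl/(_ dK)//|/ltW X0] := leP 0 X.
  rewrite (_ : torus_coord X Y K = torus_coord (- X) (- Y) (fun i => K (i + 3))).
    by apply: wl; [rewrite oppr_ge0|exact: torus_dataN].
  by apply/funext => s; rewrite torus_coordN.
move=> dK; have XY := dK.1; rewrite (ger0_norm X0) in XY.
have [d [j [a0 [b0 [a1 [b1 [e de [a00 b00 a10 b10] [sX sY ba] _]]]]]]] :=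
  torus_data_shape X0 dK.
rewrite (_ : torus_coord X Y K = torus_shape d j a0 b0 a1 b1); last exact/funext.
apply: torus_shape_barycentric => //; last by rewrite sX sY.
by rewrite de; case: ifP.
Qed.

Lemma torus_coord_inj X Y K X' Y' K' : torus_data X Y K -> torus_data X' Y' K' ->
  torus_coord X Y K =1 torus_coord X' Y' K' ->
  [/\ X = X', Y = Y' & K =1 K'] \/ [/\ X = - X', Y = - Y' & forall i, K i = K' (i + 3)].
Proof.
have i33 (i : 'I_6) : i + 3 + 3 = i by elim/ord6_ind: i; apply: val_inj.
wlog X0 : X Y K / 0 <= X => [wl dK dK' e|].
  have [X0|/ltW X0] := leP 0 X; first exact: wl.
  have X0' : 0 <= - X by rewrite oppr_ge0.
  have [|[eX eY eK]|[eX eY eK]] := wl _ _ _ X0' (torus_dataN dK) dK'.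
  - by move=> s; rewrite torus_coordN.
  - right; rewrite -eX -eY !opprK; split => // i.
    by rewrite -eK i33.
  - left; split; [exact: oppr_inj|exact: oppr_inj|] => i.
    by rewrite -(i33 i) eK i33.
wlog X'0 : X' Y' K' / 0 <= X' => [wl dK dK' e|].
  have [X'0|/ltW X'0] := leP 0 X'; first exact: wl.
  have X0' : 0 <= - X' by rewrite oppr_ge0.
  have [|[eX eY eK]|[eX eY eK]] := wl _ _ _ X0' dK (torus_dataN dK').
  - by move=> s; rewrite torus_coordN.
  - by right; split.
  - by left; rewrite eX eY !opprK; split => // i; rewrite eK i33.
(* This ordering leaves [Y' < 0 <= Y] as the only case with different shifts. *)
wlog YY' : X Y K X' Y' K' X0 X'0 / Y' <= Y => [wl dK dK' e|dK dK' e].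
  have [YY'|/ltW YY'] := leP Y' Y; first exact: wl.
  have [|[-> -> eK]|[-> -> eK]] := wl X' Y' K' X Y K X'0 X0 YY' dK' dK.
  - by move=> s; rewrite e.
  - by left; split => // i; rewrite eK.
  - by right; rewrite !opprK; split => // i; rewrite eK i33.
have [d [j [a0 [b0 [a1 [b1 [h de [a00 b00 a10 b10] [sX sY ba] hK]]]]]]] :=
  torus_data_shape X0 dK.
have [d' [j' [a0' [b0' [a1' [b1' [h' de' [a00' b00' a10' b10'] [sX' sY' ba'] hK']]]]]]] :=
  torus_data_shape X'0 dK'.
have eh s : torus_shape d j a0 b0 a1 b1 s = torus_shape d' j' a0' b0' a1' b1' s.
  by rewrite -h -h' e.
have XX : X = X'.
  by rewrite -sX -sX' -(sum_shape_row0 d j a0 b0 a1 b1)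
    -(sum_shape_row0 d' j' a0' b0' a1' b1'); apply: eq_bigr => i _; exact: eh.
have YY : `|Y| = `|Y'|.
  by rewrite -sY -sY' -(sum_shape_row1 d j a0 b0 a1 b1)
    -(sum_shape_row1 d' j' a0' b0' a1' b1'); apply: eq_bigr => i _; exact: eh.
have kap i : K i = torus_shape d j a0 b0 a1 b1 (false, i) +
    torus_shape d j a0 b0 a1 b1 (true, i - d).
  rewrite hK /torus_shape /= subrK /edge_coord; ring.
have kap' i : K' i = torus_shape d j a0 b0 a1 b1 (false, i) +
    torus_shape d j a0 b0 a1 b1 (true, i - d').
  rewrite hK' !eh /torus_shape /= subrK /edge_coord; ring.
have [dd|dd] := eqVneq d d'.
  left; split=> //; last by move=> i; rewrite kap kap' dd.
  move: dd; rewrite de de' => dd; move: YY dd.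
  have [Y0|Y0] := leP 0 Y; have [Y'0|Y'0] := leP 0 Y' => //.
  - by rewrite !ger0_norm.
  - by rewrite !ltr0_norm// => /oppr_inj.
have [Y0 Y'0] : 0 <= Y /\ Y' < 0.
  move: dd; rewrite de de'; case: (leP 0 Y); case: (leP 0 Y') => //.
  by move=> Y'0 Y0; have := lt_le_trans Y0 (le_trans Y'0 YY'); rewrite ltxx.
have d0 : d = 0 by rewrite de Y0.
have d3 : d' = 3 by rewrite de' leNgt Y'0.
rewrite (ger0_norm Y0) (ltr0_norm Y'0) in YY.
(* Here [Y' = - Y]. With [X = 0] the two points are antipodal; otherwise both rows carry weight,
   which leads to a contradiction. *)
have [X00|Xn0] := eqVneq X 0.
  right; split; [by rewrite -XX X00 oppr0|by []|] => i.
  have a0z : a0 = 0 by lra.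
  have b0z : b0 = 0 by lra.
  rewrite kap kap' d0 d3 a0z b0z /torus_shape /= addrK subr0.
  by rewrite /edge_coord !mul0r.
exfalso.
have [i hi] : exists i, torus_shape d j a0 b0 a1 b1 (false, i) != 0.
  apply: contrapT => /forallNP hi; move: Xn0; rewrite -sX -(sum_shape_row0 d j a0 b0 a1 b1).
  by rewrite big1 ?eqxx// => i _; apply/eqP; apply: contra_notT (hi i).
have [k hk] : exists k, torus_shape d j a0 b0 a1 b1 (true, k) != 0.
  apply: contrapT => /forallNP hk; have : `|Y| != 0 by rewrite ger0_norm//; lra.
  rewrite -sY -(sum_shape_row1 d j a0 b0 a1 b1).
  by rewrite big1 ?eqxx// => k _; apply/eqP; apply: contra_notT (hk k).
have := hi; have := hk; rewrite !eh {1 2}/torus_shape /=.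
move=> /edge_coord_neq0 hk' /edge_coord_neq0 hi'.
move: hi hk; rewrite /torus_shape /= d0 addr0 => /edge_coord_neq0 hi /edge_coord_neq0 hk.
have ba0 : ~ (b0 != 0 /\ a1 != 0).
  by move=> [b0n a1n]; move/eqP: ba; rewrite mulf_eq0 (negPf b0n) (negPf a1n).
have ba0' : ~ (b0' != 0 /\ a1' != 0).
  by move=> [b0n a1n]; move/eqP: ba'; rewrite mulf_eq0 (negPf b0n) (negPf a1n).
(* A cross edge has difference 0 or 1 when the shift is 0, and 3 or 4 when it is 3; the same edge
   cannot be of both kinds. *)
have ki : (k == i) || (k == i + 1).
  case: hi hk => -[-> n1] [] [-> n2]; rewrite ?eqxx ?orbT//.
  by case: ba0.
have ki' : (k + 3 == i) || (k + 3 == i + 1).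
  rewrite d3 in hk'; case: hi' hk' => -[-> n1] [] [-> n2]; rewrite ?eqxx ?orbT//.
  by case: ba0'.
by move: ki ki'; elim/ord6_ind: {+}k; elim/ord6_ind: {+}i.
Qed.

Lemma hex_clique_cases (s : 'I_6 -> R) : (forall i, 0 <= s i) ->
  (forall i k, s i != 0 -> s k != 0 -> i != k -> hex_adj i k) ->
  [\/ s =1 edge_coord 0 0 0, exists j a, 0 < a /\ s =1 edge_coord j a 0 |
      exists j a b, [/\ 0 < a, 0 < b & s =1 edge_coord j a b]].
Proof.
move=> s0 sK; have [j [a [b [a0 b0 e]]]] := hex_clique_edge s0 sK.
have [az|an] := eqVneq a 0; have [bz|bn] := eqVneq b 0.
- by apply: Or31 => i; rewrite e az bz /edge_coord !mul0r.
- apply: Or32; exists (j + 1), b; split; first by rewrite lt_neqAle eq_sym bn.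
  by move=> i; rewrite e az /edge_coord !mul0r add0r addr0.
- by apply: Or32; exists j, a; split; [rewrite lt_neqAle eq_sym an|rewrite -bz].
- by apply: Or33; exists j, a, b; split; rewrite ?lt_neqAle ?[0 == _]eq_sym ?an ?bn.
Qed.

(** Case analysis on how many vertices each row contributes to the support. The differences allowed
    by the cross edges determine the shift and the square. *)
Lemma torus_barycentric_shape (z : bool * 'I_6 -> R) : barycentric torus_adj z ->
  exists d j a0 b0 a1 b1, [/\ z =1 torus_shape d j a0 b0 a1 b1, d \in [:: 0; 3],
    [/\ 0 <= a0, 0 <= b0, 0 <= a1 & 0 <= b1] & b0 * a1 = 0].
Proof.
move=> [z0 z1 zK].
have row r := @hex_clique_cases (fun i => z (r, i)) (fun i => z0 (r, i)).
have row0 : forall i k, z (false, i) != 0 -> z (false, k) != 0 -> i != k -> hex_adj i k.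
  by move=> i k hi hk ik; apply: (zK _ _ hi hk); apply: contraNneq ik => -[->].
have row1 : forall i k, z (true, i) != 0 -> z (true, k) != 0 -> i != k -> hex_adj i k.
  by move=> i k hi hk ik; apply: (zK _ _ hi hk); apply: contraNneq ik => -[->].
have cross i k : z (false, i) != 0 -> z (true, k) != 0 -> k - i \in [:: 0; 1; 3; 4].
  by move=> hi hk; exact: (zK _ _ hi hk).
have build d j (a0 b0 a1 b1 : R) : (forall i, z (false, i) = edge_coord j a0 b0 i) ->
    (forall i, z (true, i) = edge_coord j a1 b1 (i + d)) ->
    z =1 torus_shape d j a0 b0 a1 b1.
  by move=> h0 h1 [[] i]; rewrite /torus_shape.
have shift j k d (a b : R) : j = k + d ->
    edge_coord k a b =1 (fun i => edge_coord j a b (i + d)).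
  move=> -> i; rewrite /edge_coord (inj_eq (addIr d)).
  by rewrite [k + d + 1]addrAC (inj_eq (addIr d)).
have shift1 j k d (a : R) : j + 1 = k + d ->
    edge_coord k a 0 =1 (fun i => edge_coord j 0 a (i + d)).
  move=> e i; rewrite /edge_coord e (inj_eq (addIr d)); ring.
have [h1|[k [c [c0 h1]]]|[k [c [e [c0 e0 h1]]]]] := row true row1.
- have [h0|[j [a [a0 h0]]]|[j [a [b [a0 b0 h0]]]]] := row false row0.
  + exists 0, 0, 0, 0, 0, 0; split => //; last by rewrite mulr0.
    by apply: build => // i; rewrite addr0.
  + exists 0, j, a, 0, 0, 0; split => //; [|by split=> //; exact: ltW|by rewrite mulr0].
    by apply: build => // i; rewrite h1 /edge_coord !mul0r.
  + exists 0, j, a, b, 0, 0; split => //; [|by split=> //; exact: ltW|by rewrite mulr0].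
    by apply: build => // i; rewrite h1 /edge_coord !mul0r.
- have [h0|[j [a [a0 h0]]]|[j [a [b [a0 b0 h0]]]]] := row false row0.
  + exists 0, k, 0, 0, c, 0; split => //; [|by split=> //; exact: ltW|by rewrite mul0r].
    apply: build => i; first by rewrite h0 /edge_coord !mul0r.
    by rewrite addr0.
  + have := cross j k; rewrite h0 h1 !edge_coordj !gt_eqF// => /(_ isT isT).
    (* Differences 0 and 1 belong to shift 0, differences 3 and 4 to shift 3; within each pair the
       second one is the diagonal. *)
    rewrite !inE !subr_eq => /or4P[]/eqP kj.
    * exists 0, j, a, 0, c, 0; split => //; [|by split=> //; exact: ltW|by rewrite mul0r].
      by apply: build => // i; rewrite h1; apply: shift; rewrite kj; elim/ord6_ind: {+}j; apply: val_inj.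
    * exists 0, j, a, 0, 0, c; split => //; [|by split=> //; exact: ltW|by rewrite mul0r].
      by apply: build => // i; rewrite h1; apply: shift1; rewrite kj; elim/ord6_ind: {+}j; apply: val_inj.
    * exists 3, j, a, 0, c, 0; split => //; [|by split=> //; exact: ltW|by rewrite mul0r].
      by apply: build => // i; rewrite h1; apply: shift; rewrite kj; elim/ord6_ind: {+}j; apply: val_inj.
    * exists 3, j, a, 0, 0, c; split => //; [|by split=> //; exact: ltW|by rewrite mul0r].
      by apply: build => // i; rewrite h1; apply: shift1; rewrite kj; elim/ord6_ind: {+}j; apply: val_inj.
  + have := cross j k; have := cross (j + 1) k.
    rewrite !h0 h1 edge_coordj1 !edge_coordj !gt_eqF// => /(_ isT isT) m1 /(_ isT isT) m2.
    (* Adjacency of [k] to both [j] and [j + 1] leaves the common elements of 0, 1, 3, 4 and 1, 2,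
       4, 5. *)
    have : (k == j + 1) || (k == j + 4).
      by move: m1 m2; elim/ord6_ind: {+}j; elim/ord6_ind: {+}k.
    move=> /orP[]/eqP kj.
    * exists 0, j, a, b, 0, c; split => //; [|by split=> //; exact: ltW|by rewrite mulr0].
      by apply: build => // i; rewrite h1; apply: shift1; rewrite kj; elim/ord6_ind: {+}j; apply: val_inj.
    * exists 3, j, a, b, 0, c; split => //; [|by split=> //; exact: ltW|by rewrite mulr0].
      by apply: build => // i; rewrite h1; apply: shift1; rewrite kj; elim/ord6_ind: {+}j; apply: val_inj.
- have [h0|[j [a [a0 h0]]]|[j [a [b [a0 b0 h0]]]]] := row false row0.
  + exists 0, k, 0, 0, c, e; split => //; [|by split=> //; exact: ltW|by rewrite mul0r].
    apply: build => i; first by rewrite h0 /edge_coord !mul0r.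
    by rewrite addr0.
  + have := cross j k; have := cross j (k + 1).
    rewrite h0 !h1 edge_coordj1 !edge_coordj !gt_eqF// => /(_ isT isT) m1 /(_ isT isT) m2.
    (* Adjacency of [j] to both [k] and [k + 1] leaves the common elements of 0, 1, 3, 4 and 0, 2,
       3, 5. *)
    have : (k == j) || (k == j + 3).
      by move: m1 m2; elim/ord6_ind: {+}j; elim/ord6_ind: {+}k.
    move=> /orP[]/eqP kj.
    * exists 0, j, a, 0, c, e; split => //; [|by split=> //; exact: ltW|by rewrite mul0r].
      by apply: build => // i; rewrite h1; apply: shift; rewrite kj; elim/ord6_ind: {+}j; apply: val_inj.
    * exists 3, j, a, 0, c, e; split => //; [|by split=> //; exact: ltW|by rewrite mul0r].
      by apply: build => // i; rewrite h1; apply: shift; rewrite kj; elim/ord6_ind: {+}j; apply: val_inj.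
  + have := cross j k; have := cross j (k + 1); have := cross (j + 1) k.
    rewrite !h0 !h1 !edge_coordj1 !edge_coordj !gt_eqF//.
    (* With two vertices in each row, [k - j] would have to be 1 or 4 and also 0 or 3. *)
    move=> /(_ isT isT) m1 /(_ isT isT) m2 /(_ isT isT) m3; exfalso.
    by move: m1 m2 m3; elim/ord6_ind: {+}j; elim/ord6_ind: {+}k.
Qed.

Lemma torus_coord_surj (z : bool * 'I_6 -> R) : barycentric torus_adj z ->
  exists X Y K, torus_data X Y K /\ torus_coord X Y K =1 z.
Proof.
move=> bz; have [z0 z1 _] := bz.
have [d [j [a0 [b0 [a1 [b1 [e d03 [a00 b00 a10 b10] ba]]]]]]] := torus_barycentric_shape bz.
have s1 : a0 + b0 + (a1 + b1) = 1.
  rewrite -z1 -(sum_shape_row0 d j a0 b0 a1 b1) -(sum_shape_row1 d j a0 b0 a1 b1).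
  by rewrite -sum_bool_ord; apply: eq_bigr => s _; rewrite e.
have mix : Num.min (a0 + a1) (a0 + b0) = a0 /\ Num.min (b0 + b1) (a1 + b1) = b1.
  move/eqP: ba; rewrite mulf_eq0 => /orP[]/eqP ->.
    by split; [rewrite min_r|rewrite min_l]; lra.
  by split; [rewrite min_l|rewrite min_r]; lra.
have mixp : rpos (a0 + b0 - (a0 + a1)) = b0 /\ rpos (a0 + a1 - (a0 + b0)) = a1.
  move/eqP: ba; rewrite mulf_eq0 => /orP[]/eqP ->.
    by split; [rewrite rpos0|rewrite rposE]; lra.
  by split; [rewrite rposE|rewrite rpos0]; lra.
have pick Y d' : `|Y| = a1 + b1 -> (if 0 <= Y then 0 else 3) = d' ->
    z =1 torus_shape d' j a0 b0 a1 b1 ->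
    exists X Y K, torus_data X Y K /\ torus_coord X Y K =1 z.
  move=> nY dY e'; have X0 : 0 <= a0 + b0 by rewrite addr_ge0.
  have s1' : a0 + a1 + (b0 + b1) = 1 by rewrite -s1; ring.
  exists (a0 + b0), Y, (edge_coord j (a0 + a1) (b0 + b1)); split.
    split; first by rewrite nY ger0_norm.
    by exists j, (a0 + a1), (b0 + b1); split; rewrite ?addr_ge0.
  move=> s; rewrite torus_coord_shape ?addr_ge0// nY//.
  by rewrite mix.1 mix.2 mixp.1 mixp.2 dY e'.
have Y0 : 0 <= a1 + b1 by rewrite addr_ge0.
(* With row [true] empty, the shift is not determined by [z]; it is set to 0, the convention for
   [Y = 0]. *)
have [Yz|Yn] := eqVneq (a1 + b1) 0.
  apply: (pick 0 0); rewrite ?normr0 ?lexx// => s.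
  have [a1z b1z] : a1 = 0 /\ b1 = 0 by split; lra.
  by rewrite e /torus_shape a1z b1z /edge_coord !mul0r.
move: d03 e; rewrite !inE => /orP[]/eqP -> e.
  by apply: (pick (a1 + b1) 0); rewrite ?ger0_norm// Y0.
have Yp : 0 < a1 + b1 by rewrite lt_neqAle eq_sym Yn.
apply: (pick (- (a1 + b1)) 3); rewrite ?normrN ?ger0_norm//.
by rewrite oppr_ge0 leNgt Yp.
Qed.

End torus_complex.

(** * The circle as a square and as a hexagon *)

Section circle.
Variable R : realType.
Implicit Types (x y : R) (s t : sphere R 1).

Definition cx s : R := val s ord0 ord0.
Definition cy s : R := val s ord0 ord_max.

Lemma circle_eq s : cx s ^+ 2 + cy s ^+ 2 = 1.
Proof. by rewrite -sqnorm2; exact: (set_valP s). Qed.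

Lemma circle_ext s t : cx s = cx t -> cy s = cy t -> s = t.
Proof. by move=> h1 h2; apply: val_inj; exact: row2P. Qed.

Lemma circle_coord_continuous (j : 'I_2) :
  continuous (fun s : sphere R 1 => val s ord0 j).
Proof.
move=> d; apply: (@continuous_comp _ _ _ (val : sphere R 1 -> 'rV[R]_2)
  (fun f : 'rV[R]_2 => f ord0 j)).
  exact: val_continuous.
exact: coord_continuous.
Qed.

Lemma circle_pointP x y : x ^+ 2 + y ^+ 2 = 1 -> unit_sphere (vec2 x y).
Proof. by move=> xy; rewrite /unit_sphere /= sqnorm2 vec2_0 vec2_1. Qed.

Definition circle_point x y (xy : x ^+ 2 + y ^+ 2 = 1) : sphere R 1 :=
  SigSub (mem_set (circle_pointP xy)).

Lemma circle_pointx x y xy : cx (@circle_point x y xy) = x.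
Proof. by rewrite /cx SubK vec2_0. Qed.

Lemma circle_pointy x y xy : cy (@circle_point x y xy) = y.
Proof. by rewrite /cy SubK vec2_1. Qed.

Lemma to_circle_continuous (T : topologicalType) (f : T -> sphere R 1) :
  continuous (cx \o f) -> continuous (cy \o f) -> continuous f.
Proof.
move=> fx fy; apply: continuous_set_type; apply: rV_continuous => -[[|[|//]]] Hj.
  by rewrite (_ : Ordinal Hj = ord0)//; exact: val_inj.
by rewrite (_ : Ordinal Hj = ord_max)//; exact: val_inj.
Qed.

Lemma circle_opp_eq s : (- cx s) ^+ 2 + (- cy s) ^+ 2 = 1.
Proof. by rewrite !sqrrN circle_eq. Qed.

Definition circle_opp s : sphere R 1 := circle_point (circle_opp_eq s).

Lemma circle_oppx s : cx (circle_opp s) = - cx s.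
Proof. exact: circle_pointx. Qed.

Lemma circle_oppy s : cy (circle_opp s) = - cy s.
Proof. exact: circle_pointy. Qed.

Lemma circle_neq0 s : (cx s != 0) || (cy s != 0).
Proof.
have := circle_eq s; have [->|//] := eqVneq (cx s) 0.
by have [->|//] := eqVneq (cy s) 0; rewrite expr0n /= addr0 => /eqP; rewrite eq_sym oner_eq0.
Qed.

Lemma circle_ray s t (c : R) : 0 < c -> cx s = c * cx t -> cy s = c * cy t -> s = t.
Proof.
move=> c0 ex ey; have := circle_eq s; rewrite ex ey => e.
have c2 : c ^+ 2 = 1.
  by rewrite -[RHS]e -[LHS]mulr1 -[X in _ * X](circle_eq t); ring.
have c1 : (c - 1) * (c + 1) = 0 by rewrite -subr_sqr_1 c2 subrr.
move/eqP: c1; rewrite mulf_eq0 => /orP[]/eqP c1; last by exfalso; lra.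
by apply: circle_ext; rewrite ?ex ?ey (_ : c = 1) ?mul1r//; lra.
Qed.

Lemma circle_normalize x y : (x != 0) || (y != 0) ->
  exists s (c : R), [/\ 0 < c, x = c * cx s & y = c * cy s].
Proof.
move=> xy; have q0 : 0 < x ^+ 2 + y ^+ 2.
  rewrite lt_neqAle addr_ge0 ?sqr_ge0// andbT eq_sym paddr_eq0 ?sqr_ge0//.
  by rewrite !sqrf_eq0 negb_and.
pose c := Num.sqrt (x ^+ 2 + y ^+ 2).
have c0 : 0 < c by rewrite sqrtr_gt0.
have cn := lt0r_neq0 c0.
have e : (x / c) ^+ 2 + (y / c) ^+ 2 = 1.
  by rewrite !exprMn -mulrDl exprVn sqr_sqrtr ?(ltW q0)// divff// gt_eqF.
by exists (circle_point e), c; rewrite circle_pointx circle_pointy; split => //; field.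
Qed.

(** [l1x] and [l1y] are the radial projection of the circle onto the square of points with l1 norm
    1. *)
Definition l1x s : R := cx s / (`|cx s| + `|cy s|).
Definition l1y s : R := cy s / (`|cx s| + `|cy s|).

Lemma l1_den s : 0 < `|cx s| + `|cy s|.
Proof.
have := circle_neq0 s; rewrite -!normr_gt0.
by have := normr_ge0 (cx s); have := normr_ge0 (cy s); move=> ? ? /orP[]?; lra.
Qed.

Lemma l1_sum s : `|l1x s| + `|l1y s| = 1.
Proof.
have d0 := l1_den s.
rewrite !normrM normfV -mulrDl (gtr0_norm d0) divff// gt_eqF//.
Qed.

(** Radial projection of the circle onto the hexagon, in barycentric coordinates. *)
Definition hexk s (i : 'I_6) : R := hexc (cx s) (cy s) i / hexn (cx s) (cy s).

Lemma hexk_edge s : exists j a b, [/\ 0 <= a, 0 <= b, a + b = 1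
    & hexk s =1 edge_coord j a b].
Proof.
have n0 := hexn_gt0 (circle_neq0 s).
have [j [a [b [a0 b0 _ _ h]]]] := hexcP (cx s) (cy s).
have nE : hexn (cx s) (cy s) = a + b.
  by rewrite /hexn -(sum_edge1 j); apply: eq_bigr => i _; rewrite h.
exists j, (a / hexn (cx s) (cy s)), (b / hexn (cx s) (cy s)); split.
- by rewrite divr_ge0// ltW.
- by rewrite divr_ge0// ltW.
- by rewrite -mulrDl -nE divff// gt_eqF.
- by move=> i; rewrite /hexk h /edge_coord; ring.
Qed.

Lemma hexk_inj s t : hexk s =1 hexk t -> s = t.
Proof.
move=> e; have n0 := hexn_gt0 (circle_neq0 s); have n0' := hexn_gt0 (circle_neq0 t).
have eh i : hexc (cx s) (cy s) i =
    hexn (cx s) (cy s) / hexn (cx t) (cy t) * hexc (cx t) (cy t) i.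
  have := e i; rewrite /hexk => /(canRL (divfK (lt0r_neq0 n0))) ->.
  by ring.
apply: (circle_ray (divr_gt0 n0 n0')).
- rewrite -[LHS](hexc_x (cx s) (cy s)) -[in X in _ * X](hexc_x (cx t) (cy t)) big_distrr/=.
  by apply: eq_bigr => i _; rewrite eh mulrA.
- rewrite -[LHS](hexc_y (cx s) (cy s)) -[in X in _ * X](hexc_y (cx t) (cy t)) big_distrr/=.
  by apply: eq_bigr => i _; rewrite eh mulrA.
Qed.

Lemma hexk_surj j (a b : R) : 0 <= a -> 0 <= b -> a + b = 1 ->
  exists s, hexk s =1 edge_coord j a b.
Proof.
move=> a0 b0 ab.
pose x := a * hexx R j + b * hexx R (j + 1).
pose y := a * hexy R j + b * hexy R (j + 1).
have h : hexc x y =1 edge_coord j a b by exact: hexc_edge.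
have n1 : hexn x y = 1 by rewrite /hexn -ab -(sum_edge1 j); apply: eq_bigr => i _; rewrite h.
have [|s [c [c0 xs ys]]] := @circle_normalize x y.
  have [x0|//] := eqVneq x 0; have [y0|//] := eqVneq y 0; exfalso.
  move: n1; rewrite x0 y0 /hexn big1 => [/eqP|i _]; first by rewrite eq_sym oner_eq0.
  by have := hexcZ 0 0 i (lexx (0 : R)); rewrite !mul0r.
exists s => i; rewrite -h xs ys hexcZ /hexk ?(ltW c0)//.
have -> : hexn (cx s) (cy s) = c^-1.
  apply: (mulfI (lt0r_neq0 c0)); rewrite divff ?gt_eqF// -n1 /hexn big_distrr /=.
  by apply: eq_bigr => k _; rewrite xs ys hexcZ ?(ltW c0).
by rewrite invrK mulrC.
Qed.

Lemma l1_surj (X Y : R) : `|X| + `|Y| = 1 -> exists s, l1x s = X /\ l1y s = Y.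
Proof.
move=> XY; have [|s [c [c0 xs ys]]] := @circle_normalize X Y.
  have [X0|//] := eqVneq X 0; have [Y0|//] := eqVneq Y 0; exfalso.
  by move/eqP: XY; rewrite X0 Y0 normr0 addr0 eq_sym oner_eq0.
exists s; have cn := lt0r_neq0 c0.
have e : (`|cx s| + `|cy s|) = c^-1.
  apply: (mulfI cn); rewrite divff// -XY xs ys !normrM (gtr0_norm c0); ring.
by rewrite /l1x /l1y e invrK xs ys; split; ring.
Qed.

Lemma l1_inj s t : l1x s = l1x t -> l1y s = l1y t -> s = t.
Proof.
move=> ex ey; apply: (circle_ray (divr_gt0 (l1_den s) (l1_den t))).
- have := lt0r_neq0 (l1_den s) => h; move: ex; rewrite /l1x => /(canRL (divfK h)) e.
  by rewrite [LHS]e; ring.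
- have := lt0r_neq0 (l1_den s) => h; move: ey; rewrite /l1y => /(canRL (divfK h)) e.
  by rewrite [LHS]e; ring.
Qed.

Lemma l1x_opp s : l1x (circle_opp s) = - l1x s.
Proof. by rewrite /l1x circle_oppx circle_oppy !normrN mulNr. Qed.

Lemma l1y_opp s : l1y (circle_opp s) = - l1y s.
Proof. by rewrite /l1y circle_oppx circle_oppy !normrN mulNr. Qed.

Lemma hexk_opp s i : hexk (circle_opp s) i = hexk s (i + 3).
Proof.
rewrite /hexk circle_oppx circle_oppy hexcN; congr (_ / _).
rewrite /hexn [RHS](reindex_inj (addIr 3)).
by apply: eq_bigr => k _; rewrite hexcN.
Qed.

Lemma cx_continuous : continuous cx. Proof. exact: circle_coord_continuous. Qed.
Lemma cy_continuous : continuous cy. Proof. exact: circle_coord_continuous. Qed.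

Lemma l1_den_continuous : continuous (fun s => `|cx s| + `|cy s|).
Proof.
by apply: contD; apply: cont_norm; [exact: cx_continuous|exact: cy_continuous].
Qed.

Lemma l1x_continuous : continuous l1x.
Proof.
apply: cont_div; [|exact: cx_continuous|exact: l1_den_continuous].
by move=> s; rewrite gt_eqF// l1_den.
Qed.

Lemma l1y_continuous : continuous l1y.
Proof.
apply: cont_div; [|exact: cy_continuous|exact: l1_den_continuous].
by move=> s; rewrite gt_eqF// l1_den.
Qed.

Lemma hexk_continuous i : continuous (hexk^~ i).
Proof.
have := cx_continuous; have := cy_continuous => cyc cxc.
apply: cont_div; [|exact: hexc_continuous|exact: hexn_continuous].
by move=> s; rewrite gt_eqF// hexn_gt0// circle_neq0.
Qed.

End circle.

(** * Two maps on the torus whose fibres are the antipodal pairs *)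

Section torus_homeo.
Variable R : realType.
Implicit Types p q : torus R.

Let X := realization R (clique_complex torus_adj).

Definition torus_opp p : torus R := (circle_opp p.1, circle_opp p.2).

Lemma torus_dataP p : torus_data (l1x p.1) (l1y p.1) (hexk p.2).
Proof. by split; [exact: l1_sum|exact: hexk_edge]. Qed.

Definition torus_map p : X := bary_point (torus_coord_barycentric (torus_dataP p)).

Lemma torus_mapE p s : bary (torus_map p) s = torus_coord (l1x p.1) (l1y p.1) (hexk p.2) s.
Proof. by []. Qed.

Lemma torus_map_kernel p q : torus_map p = torus_map q <-> p = q \/ p = torus_opp q.
Proof.
split=> [e|[->//|->]].
  have [|[ex ey ek]|[ex ey ek]] := torus_coord_inj (torus_dataP p) (torus_dataP q).
  - by move=> s; rewrite -!torus_mapE e.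
  - left; case: p q ex ey ek {e} => [p1 p2] [q1 q2] /= ex ey ek.
    by rewrite (l1_inj ex ey) (hexk_inj ek).
  - right; case: p q ex ey ek {e} => [p1 p2] [q1 q2] /= ex ey ek.
    rewrite /torus_opp /=; congr (_, _).
      by apply: l1_inj; rewrite ?l1x_opp ?l1y_opp.
    by apply: hexk_inj => i; rewrite hexk_opp.
apply: bary_inj => s; rewrite !torus_mapE /torus_opp /= l1x_opp l1y_opp.
rewrite -torus_coordN !opprK; apply: eq_torus_coord => i.
by rewrite hexk_opp; congr hexk; elim/ord6_ind: i; apply: val_inj.
Qed.

Lemma torus_map_surj x : exists p, torus_map p = x.
Proof.
have [a [b [K [[ab [j [c [d [c0 d0 cd eK]]]]] e]]]] := torus_coord_surj (baryP x).
have [s [sa sb]] := l1_surj ab; have [t tK] := hexk_surj j c0 d0 cd.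
exists (s, t); apply: bary_inj => v; rewrite torus_mapE /= sa sb -e.
by apply: eq_torus_coord => i; rewrite tK eK.
Qed.

Lemma posmin_continuous (T : topologicalType) (f g : T -> R) :
  continuous f -> continuous g -> continuous (fun x => posmin (f x) (g x)).
Proof. by move=> fc gc; apply: rpos_continuous; exact: cont_min. Qed.

Lemma fst_continuous (A B C : topologicalType) (f : A -> C) :
  continuous f -> continuous (fun p : A * B => f p.1).
Proof. by move=> fc p; apply: continuous_comp; [exact: cvg_fst|exact: fc]. Qed.

Lemma snd_continuous (A B C : topologicalType) (f : B -> C) :
  continuous f -> continuous (fun p : A * B => f p.2).
Proof. by move=> fc p; apply: continuous_comp; [exact: cvg_snd|exact: fc]. Qed.

Lemma torus_map_continuous : continuous torus_map.
Proof.
have xc : continuous (fun p : torus R => l1x p.1).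
  exact/fst_continuous/l1x_continuous.
have yc : continuous (fun p : torus R => l1y p.1).
  exact/fst_continuous/l1y_continuous.
have kc i : continuous (fun p : torus R => hexk p.2 i).
  exact: (snd_continuous (hexk_continuous (i := i))).
by apply: to_realization_continuous => -[[] i]; apply: contD;
  apply: posmin_continuous => //; apply: contB => //; apply: rpos_continuous => //;
  exact: contN.
Qed.

Lemma torus_compact : compact [set: torus R].
Proof. by apply: prod_compact; exact: sphere_compact. Qed.

Lemma torus_hausdorff : hausdorff_space (torus R).
Proof. by apply: prod_hausdorff; exact: sphere_hausdorff. Qed.

Lemma circle_mul_eq (s t : sphere R 1) :
  (cx s * cx t - cy s * cy t) ^+ 2 + (cx s * cy t + cy s * cx t) ^+ 2 = 1.
Proof. by rewrite -[RHS]mulr1 -{1}(circle_eq s) -(circle_eq t); ring. Qed.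

Definition circle_mul (s t : sphere R 1) : sphere R 1 := circle_point (circle_mul_eq s t).

Lemma circle_mul_continuous (T : topologicalType) (f g : T -> sphere R 1) :
  continuous f -> continuous g -> continuous (fun x => circle_mul (f x) (g x)).
Proof.
move=> fc gc.
have fx : continuous (fun x => cx (f x)).
  by move=> x; apply: continuous_comp; [exact: fc|exact: cx_continuous].
have fy : continuous (fun x => cy (f x)).
  by move=> x; apply: continuous_comp; [exact: fc|exact: cy_continuous].
have gx : continuous (fun x => cx (g x)).
  by move=> x; apply: continuous_comp; [exact: gc|exact: cx_continuous].
have gy : continuous (fun x => cy (g x)).
  by move=> x; apply: continuous_comp; [exact: gc|exact: cy_continuous].
apply: to_circle_continuous.
- rewrite (_ : _ \o _ = fun x => cx (f x) * cx (g x) - cy (f x) * cy (g x)).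
    by apply: contB; exact: contM.
  by apply/funext => x /=; rewrite circle_pointx.
- rewrite (_ : _ \o _ = fun x => cx (f x) * cy (g x) + cy (f x) * cx (g x)).
    by apply: contD; exact: contM.
  by apply/funext => x /=; rewrite circle_pointy.
Qed.

Lemma circle_mulI (s t u : sphere R 1) : circle_mul s t = circle_mul s u -> t = u.
Proof.
move=> e; have ex := congr1 (@cx R) e; have ey := congr1 (@cy R) e.
rewrite !circle_pointx in ex; rewrite !circle_pointy in ey.
have s1 := circle_eq s.
apply: circle_ext.
- rewrite -[LHS]mul1r -[RHS]mul1r -s1.
  transitivity (cx s * (cx s * cx t - cy s * cy t) + cy s * (cx s * cy t + cy s * cx t)).
    by ring.
  by rewrite ex ey; ring.
- rewrite -[LHS]mul1r -[RHS]mul1r -s1.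
  transitivity (cx s * (cx s * cy t + cy s * cx t) - cy s * (cx s * cx t - cy s * cy t)).
    by ring.
  by rewrite ex ey; ring.
Qed.

Lemma circle_mul_opp (s t : sphere R 1) : circle_mul (circle_opp s) (circle_opp t) = circle_mul s t.
Proof.
by apply: circle_ext; rewrite ?circle_pointx ?circle_pointy ?circle_oppx ?circle_oppy; ring.
Qed.

(** Together with the unit length, the real part of the square gives both squared coordinates; the
    imaginary part gives their product, which ties the two signs together. *)
Lemma circle_sqr_inj (s t : sphere R 1) :
  circle_mul s s = circle_mul t t -> s = t \/ s = circle_opp t.
Proof.
move=> e; have ex := congr1 (@cx R) e; have ey := congr1 (@cy R) e.
rewrite !circle_pointx in ex; rewrite !circle_pointy in ey.
have s1 := circle_eq s; have t1 := circle_eq t.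
have xx : cx s ^+ 2 = cx t ^+ 2 by lra.
have yy : cy s ^+ 2 = cy t ^+ 2 by lra.
have xy : cx s * cy s = cx t * cy t by lra.
have [x0|x0] := eqVneq (cx t) 0.
  have sx0 : cx s = 0 by apply/eqP; rewrite -sqrf_eq0 xx x0 expr0n.
  move/eqP: yy; rewrite eqf_sqr => /orP[]/eqP yy; [left|right]; apply: circle_ext;
    by rewrite ?circle_oppx ?circle_oppy ?x0 ?sx0 ?oppr0.
move/eqP: xx; rewrite eqf_sqr => /orP[]/eqP xx; [left|right]; apply: circle_ext;
  rewrite ?circle_oppx ?circle_oppy//; apply: (mulfI x0).
- by rewrite -xy xx.
- by rewrite mulrN -xy xx; ring.
Qed.

Lemma circle_sqrt (s : sphere R 1) : exists t, circle_mul t t = s.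
Proof.
have s1 := circle_eq s.
have x1 : -1 <= cx s <= 1.
  have := sqr_ge0 (cy s) => y2; rewrite -ler_norml -(@ler_pXn2r _ 2) ?nnegrE//.
  by rewrite expr1n -normrX ger0_norm ?sqr_ge0//; lra.
(* Half-angle formulas, up to sign; the sign of [cy s] decides between [b] and [- b]. *)
pose a := Num.sqrt ((1 + cx s) / 2); pose b := Num.sqrt ((1 - cx s) / 2).
have a2 : a ^+ 2 = (1 + cx s) / 2 by rewrite sqr_sqrtr//; lra.
have b2 : b ^+ 2 = (1 - cx s) / 2 by rewrite sqr_sqrtr//; lra.
have a0 : 0 <= a by exact: sqrtr_ge0.
have b0 : 0 <= b by exact: sqrtr_ge0.
have ab : 2 * (a * b) = `|cy s|.
  apply/eqP; rewrite -(@eqrXn2 _ 2)// ?mulr_ge0//.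
  rewrite !exprMn a2 b2 -normrX ger0_norm ?sqr_ge0//; apply/eqP.
  have -> : cy s ^+ 2 = 1 - cx s ^+ 2 by rewrite -s1; ring.
  by field.
have [y0|y0] := leP 0 (cy s).
  have e : a ^+ 2 + b ^+ 2 = 1 by lra.
  exists (circle_point e); apply: circle_ext;
    rewrite ?(circle_pointx (circle_mul_eq _ _)) ?(circle_pointy (circle_mul_eq _ _))
      circle_pointx circle_pointy.
    by rewrite -!expr2; lra.
  by rewrite ger0_norm in ab; lra.
have e : a ^+ 2 + (- b) ^+ 2 = 1 by rewrite sqrrN; lra.
exists (circle_point e); apply: circle_ext;
  rewrite ?(circle_pointx (circle_mul_eq _ _)) ?(circle_pointy (circle_mul_eq _ _))
    circle_pointx circle_pointy.
  by rewrite mulrNN -!expr2; lra.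
by rewrite ltr0_norm in ab; lra.
Qed.

Definition torus_cover p : torus R := (circle_mul p.1 p.1, circle_mul p.1 p.2).

Lemma torus_cover_continuous : continuous torus_cover.
Proof.
have c1 : continuous (fun p : torus R => p.1) by move=> p; exact: cvg_fst.
have c2 : continuous (fun p : torus R => p.2) by move=> p; exact: cvg_snd.
have cc1 := circle_mul_continuous c1 c1; have cc2 := circle_mul_continuous c1 c2.
by move=> p; exact: (cvg_pair (cc1 p) (cc2 p)).
Qed.

Lemma torus_cover_surj p : exists q, torus_cover q = p.
Proof.
have [s s1] := circle_sqrt p.1.
(* The second component of the preimage is [p.2] times the complex conjugate of [s]. *)
have e : (cx s * cx p.2 + cy s * cy p.2) ^+ 2 + (cx s * cy p.2 - cy s * cx p.2) ^+ 2 = 1.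
  by rewrite -[RHS]mulr1 -{1}(circle_eq s) -(circle_eq p.2); ring.
exists (s, circle_point e); rewrite [RHS]surjective_pairing /torus_cover /= s1.
congr (_, _); have s2 := circle_eq s; apply: circle_ext;
  rewrite ?(circle_pointx (circle_mul_eq _ _)) ?(circle_pointy (circle_mul_eq _ _))
    circle_pointx circle_pointy -[RHS]mul1r -s2; ring.
Qed.

Lemma torus_cover_kernel p q : torus_cover p = torus_cover q <-> p = q \/ p = torus_opp q.
Proof.
split=> [|[->//|->]]; last first.
  by rewrite /torus_cover /torus_opp /= !circle_mul_opp.
case: p q => [p1 p2] [q1 q2] e; have e1 := congr1 fst e; have e2 := congr1 snd e.
have [/= e3|/= e3] := circle_sqr_inj e1; move: e2; rewrite /torus_cover /torus_opp /= e3.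
  by move=> /circle_mulI ->; left.
by rewrite -(circle_mul_opp q1 q2) => /circle_mulI ->; right.
Qed.

Lemma torus_homeomorphic : homeomorphic X (torus R).
Proof.
apply: (@homeomorphic_of_quotient_maps (torus R) _ _ torus_map torus_cover).
- apply: compact_hausdorff_quotient_map.
  + exact: torus_map_continuous.
  + exact: torus_map_surj.
  + exact: torus_compact.
  + exact: realization_hausdorff.
- apply: compact_hausdorff_quotient_map.
  + exact: torus_cover_continuous.
  + exact: torus_cover_surj.
  + exact: torus_compact.
  + exact: torus_hausdorff.
- by move=> p q; rewrite torus_map_kernel torus_cover_kernel.
Qed.

Lemma torus_summand : exists (c d : 'I_6 -> bool * 'I_6),
  summand R (torus R) torus_adj (false, 0) (true, o6 2) c d.
Proof.
do 2!eexists; split.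
- exact: torus_star0.
- exact: torus_star1.
- by [].
- exact: compact_surj torus_map_continuous torus_map_surj torus_compact.
- exact: torus_homeomorphic.
Qed.

Lemma torus_card : #|{: bool * 'I_6}| = (8 + 4)%N.
Proof. by rewrite card_prod card_bool card_ord. Qed.

End torus_homeo.

(** * The projective plane *)

(** One triangle for each antipodal pair of cones of the fan, 20 in all; the numbering of the rays
    is the one listed with [hat]. *)
Definition rp_facets : seq (seq nat) :=
  [:: [:: 0; 3; 7]; [:: 0; 3; 9]; [:: 0; 4; 8]; [:: 0; 4; 10]; [:: 0; 7; 10];
      [:: 0; 9; 8]; [:: 3; 7; 5]; [:: 3; 9; 6]; [:: 4; 8; 5]; [:: 4; 10; 6];
      [:: 3; 5; 2]; [:: 3; 6; 2]; [:: 4; 5; 2]; [:: 4; 6; 2]; [:: 7; 5; 1];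
      [:: 9; 6; 1]; [:: 8; 5; 1]; [:: 10; 6; 1]; [:: 7; 10; 1]; [:: 9; 8; 1]]%N.

Definition rp_edge (m n : nat) : bool :=
  (m != n) && has (fun f : seq nat => (m \in f) && (n \in f)) rp_facets.

Definition rp_adj (u v : 'I_11) : bool := rp_edge u v.

Lemma ord11_ind (P : 'I_11 -> Prop) :
  P (@Ordinal 11 0 isT) -> P (@Ordinal 11 1 isT) -> P (@Ordinal 11 2 isT) ->
  P (@Ordinal 11 3 isT) -> P (@Ordinal 11 4 isT) -> P (@Ordinal 11 5 isT) ->
  P (@Ordinal 11 6 isT) -> P (@Ordinal 11 7 isT) -> P (@Ordinal 11 8 isT) ->
  P (@Ordinal 11 9 isT) -> P (@Ordinal 11 10 isT) -> forall i, P i.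
Proof.
move=> P0 P1 P2 P3 P4 P5 P6 P7 P8 P9 P10.
by move=> [[|[|[|[|[|[|[|[|[|[|[|//]]]]]]]]]]] Hm]; rewrite (bool_irrelevance Hm isT).
Qed.

Definition o11 (n : nat) : 'I_11 := inZp n.

Lemma rp_star0 : hex_star rp_adj (o11 0) (fun i => nth (o11 0)
  [:: o11 7; o11 3; o11 9; o11 8; o11 4; o11 10] i).
Proof.
apply: hex_star_of_seq => //.
- by elim/ord11_ind.
- by move=> i k; elim/ord6_ind: i; elim/ord6_ind: k.
Qed.

Lemma rp_star1 : hex_star rp_adj (o11 1) (fun i => nth (o11 1)
  [:: o11 7; o11 5; o11 8; o11 9; o11 6; o11 10] i).
Proof.
apply: hex_star_of_seq => //.
- by elim/ord11_ind.
- by move=> i k; elim/ord6_ind: i; elim/ord6_ind: k.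
Qed.

(** * Cliques of the graph on 11 vertices *)

Fixpoint bitseqs (n : nat) : seq bitseq :=
  if n is n'.+1 then [seq true :: s | s <- bitseqs n'] ++ [seq false :: s | s <- bitseqs n']
  else [:: [::]].

Lemma mem_bitseqs s : s \in bitseqs (size s).
Proof.
elim: s => [|b s IH] //=; rewrite mem_cat.
by case: b; apply/orP; [left|right]; exact: map_f.
Qed.

Definition rp_cliqueb (s : bitseq) : bool :=
  all (fun m => all (fun n => [&& nth false s m, nth false s n & m != n] ==>
    rp_edge m n) (iota 0 11)) (iota 0 11).

Definition rp_coveredb (s : bitseq) : bool :=
  has (fun f : seq nat => all (fun n => nth false s n ==> (n \in f)) (iota 0 11)) rp_facets.

(** This is flagness of the triangulation: no clique goes beyond a listed triangle. All 2048 vertex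
    sets are tested. *)
Lemma rp_clique_covered_bits :
  all (fun s => rp_cliqueb s ==> rp_coveredb s) (bitseqs 11).
Proof. by vm_compute. Qed.

Lemma rp_clique_covered (S : nat -> bool) :
  (forall m n, (m < 11)%N -> (n < 11)%N -> S m -> S n -> m != n -> rp_edge m n) ->
  exists2 f, f \in rp_facets & forall n, (n < 11)%N -> S n -> n \in f.
Proof.
move=> SK; pose s := mkseq S 11.
have sS n : (n < 11)%N -> nth false s n = S n by move=> n11; rewrite nth_mkseq.
have := allP rp_clique_covered_bits s; rewrite -{1}(size_mkseq S 11) mem_bitseqs.
move=> /(_ isT)/implyP cov; have /cov/hasP[f fF /allP fs] : rp_cliqueb s.
  apply/allP => m; rewrite mem_iota => /andP[_ m11].
  apply/allP => n; rewrite mem_iota => /andP[_ n11].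
  by apply/implyP; rewrite !sS// => /and3P[]; exact: SK.
exists f => // n n11 Sn.
have /fs : n \in iota 0 11 by rewrite mem_iota.
by rewrite sS// Sn.
Qed.

(** * Piecewise linear coordinates of the fan *)

Section rp_hats.
Variable R : realType.
Implicit Types x y z a b c : R.

(** Coordinate of the ray (1, 1, 1). It lies in five cones, and the five linear forms are its
    coordinate in each of them. *)
Definition quint x y z : R := rpos (Num.min x (Num.min z
  (Num.min ((x + y) / 2) (Num.min ((z + y) / 2) (x - y + z))))).

(** The vertices are the sign vectors up to sign, in the order
    (0,0,1), (1,0,0), (0,1,0), (0,1,1), (0,1,-1), (1,1,0), (-1,1,0),
    (1,1,1), (1,1,-1), (-1,1,1), (-1,1,-1), and [hat x y z] lists the coordinates
    of (x,y,z) in the cone of the fan that contains it. *)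
Definition hat x y z (n : nat) : R := nth 0
  [:: rpos (`|z| - Num.max `|x| `|y|);
      rpos (`|x| - Num.max `|y| `|z|);
      rpos (`|y| - (`|x| + `|z|));
      posmin z (y - `|x|) + posmin (- z) (- y - `|x|);
      posmin (- z) (y - `|x|) + posmin z (- y - `|x|);
      posmin x (y - `|z|) + posmin (- x) (- y - `|z|);
      posmin (- x) (y - `|z|) + posmin x (- y - `|z|);
      quint x y z + quint (- x) (- y) (- z);
      quint x y (- z) + quint (- x) (- y) z;
      quint (- x) y z + quint x (- y) (- z);
      quint (- x) y (- z) + quint x (- y) z] n.

(** Action of the reflection of the first coordinate on the rays up to sign; numbers from 11 on are
    fixed, where [hat] is 0. *)
Definition flipx (n : nat) : nat := nth n [:: 0; 1; 2; 3; 4; 6; 5; 9; 10; 7; 8]%N n.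
Definition flipz (n : nat) : nat := nth n [:: 0; 1; 2; 4; 3; 5; 6; 8; 7; 10; 9]%N n.

Lemma flipxK : involutive flipx.
Proof. by move=> [|[|[|[|[|[|[|[|[|[|[|n]]]]]]]]]]] //; rewrite /flipx !nth_default. Qed.

Lemma flipzK : involutive flipz.
Proof. by move=> [|[|[|[|[|[|[|[|[|[|[|n]]]]]]]]]]] //; rewrite /flipz !nth_default. Qed.

Lemma nat11P (P : nat -> Prop) : P 0%N -> P 1%N -> P 2%N -> P 3%N -> P 4%N -> P 5%N ->
  P 6%N -> P 7%N -> P 8%N -> P 9%N -> P 10%N -> (forall n, P (11 + n)%N) -> forall n, P n.
Proof.
move=> ? ? ? ? ? ? ? ? ? ? ? Pn [|[|[|[|[|[|[|[|[|[|[|n]]]]]]]]]]] //; exact: (Pn n).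
Qed.

Lemma hat_big x y z n : hat x y z (11 + n) = 0.
Proof. by rewrite /hat nth_default. Qed.

Lemma hat_flipx x y z n : hat (- x) y z n = hat x y z (flipx n).
Proof.
elim/nat11P: n => [|||||||||||n]; last by rewrite [flipx _]nth_default// !hat_big.
all: by rewrite /hat /= ?normrN ?opprK// addrC.
Qed.

Lemma hat_flipz x y z n : hat x y (- z) n = hat x y z (flipz n).
Proof.
elim/nat11P: n => [|||||||||||n]; last by rewrite [flipz _]nth_default// !hat_big.
all: by rewrite /hat /= ?normrN ?opprK// addrC.
Qed.

Lemma hat_even x y z n : hat (- x) (- y) (- z) n = hat x y z n.
Proof.
elim/nat11P: n => [|||||||||||n]; last by rewrite !hat_big.
all: by rewrite /hat /= ?normrN ?opprK// addrC.
Qed.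

Lemma hat_ge0 x y z n : 0 <= hat x y z n.
Proof.
elim/nat11P: n => [|||||||||||n]; last by rewrite hat_big.
all: by rewrite /hat /= ?addr_ge0// rpos_ge0.
Qed.

Definition tri (p q r : nat) a b c (n : nat) : R :=
  a * (n == p)%:R + b * (n == q)%:R + c * (n == r)%:R.

Lemma posmin0l a b : a <= 0 -> posmin a b = 0.
Proof. by move=> a0; rewrite /posmin rpos0// ge_min a0. Qed.

Lemma posmin_l a b : 0 <= a -> a <= b -> posmin a b = a.
Proof. by move=> a0 ab; rewrite /posmin min_l// rposE. Qed.

Lemma posmin_r a b : 0 <= b -> b <= a -> posmin a b = b.
Proof. by move=> b0 ba; rewrite /posmin min_r// rposE. Qed.

Lemma quint0 x y z : [|| x <= 0, z <= 0, (x + y) / 2 <= 0, (z + y) / 2 <= 0 | x - y + z <= 0] ->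
  quint x y z = 0.
Proof. by move=> h; rewrite /quint rpos0// !ge_min. Qed.

(** A lower bound together with one form attaining it avoids deciding how the five forms are
    ordered. *)
Lemma quintE x y z v : 0 <= v ->
  [&& v <= x, v <= z, v <= (x + y) / 2, v <= (z + y) / 2 & v <= x - y + z] ->
  [|| x <= v, z <= v, (x + y) / 2 <= v, (z + y) / 2 <= v | x - y + z <= v] ->
  quint x y z = v.
Proof.
move=> v0 h1 h2; have e : Num.min x (Num.min z
  (Num.min ((x + y) / 2) (Num.min ((z + y) / 2) (x - y + z)))) = v.
  by apply/eqP; rewrite eq_le !ge_min !le_min h1 h2.
by rewrite /quint e rposE.
Qed.

End rp_hats.

Ltac pick_or := first [ lra | apply/orP; left; lra | apply/orP; right; pick_or ].
Ltac all_and := first [ lra | apply/andP; split; [lra|all_and] ].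

Ltac eval_hat := repeat match goal with
  | |- context [Num.max ?a ?b] =>
      first [ rewrite (@max_l _ _ a b); last lra
            | rewrite (@max_r _ _ a b); last lra ]
  | |- context [posmin ?a ?b] =>
      first [ rewrite (@posmin0l _ a b); last lra
            | rewrite (@posmin0 _ a b); last lra
            | rewrite (@posmin_l _ a b); [|lra|lra]
            | rewrite (@posmin_r _ a b); [|lra|lra] ]
  | |- context [quint ?a ?b ?c] =>
      rewrite (@quint0 _ a b c); last by pick_or
  | |- context [rpos ?a] =>
      first [ rewrite (@rposE _ a); last lra | rewrite (@rpos0 _ a); last lra ]
  end.

Ltac check_tri :=
  apply: nat11P => [|||||||||||n]; last (by rewrite hat_big /tri !mulr0 !addr0);
  rewrite /hat /tri /=; do ?(rewrite ger0_norm; last lra); eval_hat;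
  first [ lra
        | rewrite ?addr0 ?add0r ?mulr0 ?mulr1 ?addr0 ?add0r;
          apply: quintE; [lra|all_and|pick_or] ].

(** * The cones that meet the positive octant *)

Section rp_octant.
Variable R : realType.
Implicit Types x y z a b c : R.

Lemma hat_cone1 a b c : 0 <= a -> 0 <= b -> 0 <= c ->
  hat c (b + c) (a + b + c) =1 tri 0 3 7 a b c.
Proof. by move=> a0 b0 c0; check_tri. Qed.

(** This cone crosses the plane [y = 0]; [c <= b] selects its half in the octant. The cone on 7, 10,
    1 is halved in the same way. *)
Lemma hat_cone2 a b c : 0 <= a -> 0 <= c -> c <= b ->
  hat (b + c) (b - c) (a + b + c) =1 tri 0 7 10 a b c.
Proof. by move=> a0 c0 cb; check_tri. Qed.

Lemma hat_cone3 a b c : 0 <= a -> 0 <= b -> 0 <= c ->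
  hat (b + c) (a + b + c) (a + b) =1 tri 3 7 5 a b c.
Proof. by move=> a0 b0 c0; check_tri. Qed.

Lemma hat_cone4 a b c : 0 <= a -> 0 <= b -> 0 <= c ->
  hat b (a + b + c) a =1 tri 3 5 2 a b c.
Proof. by move=> a0 b0 c0; check_tri. Qed.

Lemma hat_cone5 a b c : 0 <= a -> 0 <= b -> 0 <= c ->
  hat (a + b + c) (a + b) a =1 tri 7 5 1 a b c.
Proof. by move=> a0 b0 c0; check_tri. Qed.

Lemma hat_cone6 a b c : 0 <= b -> b <= a -> 0 <= c ->
  hat (a + b + c) (a - b) (a + b) =1 tri 7 10 1 a b c.
Proof. by move=> a0 b0 c0; check_tri. Qed.

End rp_octant.

Ltac use_cone a b c :=
  rewrite ?(@hat_cone1 _ a b c) ?(@hat_cone2 _ a b c) ?(@hat_cone3 _ a b c)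
    ?(@hat_cone4 _ a b c) ?(@hat_cone5 _ a b c) ?(@hat_cone6 _ a b c).

(** * Symmetries, injectivity and surjectivity of the coordinates *)

Section rp_fan.
Variable R : realType.
Implicit Types x y z a b c : R.

(** The flips of [x] and [z] and the antipodal map generate all sign changes, so it suffices to
    treat the six cones, two of them halved, that fill the positive octant. *)
Lemma fan_ind (P : R -> R -> R -> Prop) :
  (forall x y z, P x y z -> P (- x) y z) ->
  (forall x y z, P x y z -> P x y (- z)) ->
  (forall x y z, P x y z -> P (- x) (- y) (- z)) ->
  (forall a b c, 0 <= a -> 0 <= b -> 0 <= c -> P c (b + c) (a + b + c)) ->
  (forall a b c, 0 <= a -> 0 <= c -> c <= b -> P (b + c) (b - c) (a + b + c)) ->
  (forall a b c, 0 <= a -> 0 <= b -> 0 <= c -> P (b + c) (a + b + c) (a + b)) ->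
  (forall a b c, 0 <= a -> 0 <= b -> 0 <= c -> P b (a + b + c) a) ->
  (forall a b c, 0 <= a -> 0 <= b -> 0 <= c -> P (a + b + c) (a + b) a) ->
  (forall a b c, 0 <= b -> b <= a -> 0 <= c -> P (a + b + c) (a - b) (a + b)) ->
  forall x y z, P x y z.
Proof.
move=> Px Pz PN P1 P2 P3 P4 P5 P6.
have oct x y z : 0 <= x -> 0 <= y -> 0 <= z -> P x y z.
  move=> x0 y0 z0.
  have cast x' y' z' : x' = x -> y' = y -> z' = z -> P x' y' z' -> P x y z.
    by move=> -> -> ->.
  have [xy|yx] := leP x y.
    have [yz|zy] := leP y z.
      by apply: cast (P1 (z - y) (y - x) x _ _ _); lra.
    have [yxz|xzy] := leP y (x + z).
      by apply: cast (P3 (y - x) (x - y + z) (y - z) _ _ _); lra.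
    by apply: cast (P4 z x (y - x - z) _ _ _); lra.
  have [xz|zx] := leP x z.
    by apply: cast (P2 (z - x) ((x + y) / 2) ((x - y) / 2) _ _ _); lra.
  have [yz|zy] := leP y z.
    by apply: cast (P6 ((z + y) / 2) ((z - y) / 2) (x - z) _ _ _); lra.
  by apply: cast (P5 z (y - z) (x - y) _ _ _); lra.
have octy x y z : 0 <= y -> P x y z.
  move=> y0; have [x0|/ltW x0] := leP 0 x; have [z0|/ltW z0] := leP 0 z.
  - exact: oct.
  - by rewrite -(opprK z); apply: Pz; apply: oct; rewrite ?oppr_ge0.
  - by rewrite -(opprK x); apply: Px; apply: oct; rewrite ?oppr_ge0.
  - rewrite -(opprK x) -(opprK z); apply: Px; apply: Pz.
    by apply: oct; rewrite ?oppr_ge0.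
move=> x y z; have [y0|/ltW y0] := leP 0 y; first exact: octy.
rewrite -(opprK x) -(opprK y) -(opprK z); apply: PN.
by apply: octy; rewrite oppr_ge0.
Qed.

Lemma hatZ t x y z n : 0 <= t -> hat (t * x) (t * y) (t * z) n = t * hat x y z n.
Proof.
move=> t0; move: x y z n; apply: fan_ind => [x y z IH n|x y z IH n|x y z IH n|||||| ].
- by rewrite mulrN !hat_flipx.
- by rewrite mulrN !hat_flipz.
- by rewrite !mulrN !hat_even.
all: move=> a b c h1 h2 h3 n; rewrite ?(mulrBr, mulrDr).
all: use_cone a b c; use_cone (t * a) (t * b) (t * c); rewrite ?mulr_ge0 ?ler_wpM2l//.
all: by rewrite /tri; ring.
Qed.

(** Rays of one cone never have first coordinates of opposite sign, so the absolute values add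
    up. *)
Lemma hat_normx x y z : `|x| = hat x y z 1 + (hat x y z 5 + hat x y z 6) +
  (hat x y z 7 + hat x y z 9) + (hat x y z 8 + hat x y z 10).
Proof.
move: x y z; apply: fan_ind => [x y z IH|x y z IH|x y z IH|||||| ].
- by rewrite normrN IH !hat_flipx /=; ring.
- by rewrite IH !hat_flipz /=; ring.
- by rewrite normrN IH !hat_even.
all: move=> a b c h1 h2 h3; use_cone a b c => //; rewrite /tri /= ger0_norm; lra.
Qed.

Lemma hat_normz x y z : `|z| = hat x y z 0 + (hat x y z 3 + hat x y z 4) +
  (hat x y z 7 + hat x y z 8) + (hat x y z 9 + hat x y z 10).
Proof.
move: x y z; apply: fan_ind => [x y z IH|x y z IH|x y z IH|||||| ].
- by rewrite IH !hat_flipx /=; ring.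
- by rewrite normrN IH !hat_flipz /=; ring.
- by rewrite normrN IH !hat_even.
all: move=> a b c h1 h2 h3; use_cone a b c => //; rewrite /tri /= ger0_norm; lra.
Qed.

(** Unlike for [x] and [z], a cone may contain rays with opposite second coordinates, such as (1, 1,
    1) and (1, -1, 1); the pairs 7, 10 and 8, 9 therefore enter through differences. *)
Lemma hat_normy x y z : `|y| = hat x y z 2 + (hat x y z 3 + hat x y z 4) +
  (hat x y z 5 + hat x y z 6) + `|hat x y z 7 - hat x y z 10| +
  `|hat x y z 8 - hat x y z 9|.
Proof.
move: x y z; apply: fan_ind => [x y z IH|x y z IH|x y z IH|||||| ].
- by rewrite IH !hat_flipx /= [`|_ 9%N - _|]distrC [`|_ 10%N - _|]distrC; ring.
- by rewrite IH !hat_flipz /=; ring.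
- by rewrite normrN IH !hat_even.
all: move=> a b c h1 h2 h3; use_cone a b c => //; rewrite /tri /= !ger0_norm; lra.
Qed.

Lemma flip_facets :
  all (fun f => has (fun f' => all (fun n => (flipx n \in f) ==> (n \in f')) (iota 0 11))
    rp_facets && has (fun f' => all (fun n => (flipz n \in f) ==> (n \in f')) (iota 0 11))
    rp_facets) rp_facets.
Proof. by vm_compute. Qed.

Lemma hat_support x y z : exists2 f, f \in rp_facets & forall n, hat x y z n != 0 -> n \in f.
Proof.
have lt11 (u v w : R) n : hat u v w n != 0 -> n \in iota 0 11.
  rewrite mem_iota leq0n /= add0n; apply: contraNT; rewrite -leqNgt => n11.
  by rewrite -(subnKC n11) hat_big.
move: x y z; apply: fan_ind => [x y z [f fF fh]|x y z [f fF fh]|x y z [f fF fh]|||||| ].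
- have /andP[/hasP[f' f'F /allP ff'] _] := allP flip_facets f fF.
  exists f' => // n hn; have /implyP := ff' n (lt11 _ _ _ _ hn); apply.
  by apply: fh; rewrite -hat_flipx.
- have /andP[_ /hasP[f' f'F /allP ff']] := allP flip_facets f fF.
  exists f' => // n hn; have /implyP := ff' n (lt11 _ _ _ _ hn); apply.
  by apply: fh; rewrite -hat_flipz.
- by exists f => // n; rewrite hat_even; exact: fh.
all: move=> a b c h1 h2 h3.
all: have supp p q r (g : nat -> R) : g =1 tri p q r a b c ->
       forall n, g n != 0 -> n \in [:: p; q; r]
     by move=> g_tri n; apply: contraNT; rewrite g_tri /tri !inE !negb_or;
        case/and3P => /negPf -> /negPf -> /negPf ->; rewrite !mulr0 !addr0.
- by exists [:: 0; 3; 7]%N => //; apply: supp; exact: hat_cone1.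
- by exists [:: 0; 7; 10]%N => //; apply: supp; exact: hat_cone2.
- by exists [:: 3; 7; 5]%N => //; apply: supp; exact: hat_cone3.
- by exists [:: 3; 5; 2]%N => //; apply: supp; exact: hat_cone4.
- by exists [:: 7; 5; 1]%N => //; apply: supp; exact: hat_cone5.
- by exists [:: 7; 10; 1]%N => //; apply: supp; exact: hat_cone6.
Qed.

Lemma hat_edge x y z m n : hat x y z m != 0 -> hat x y z n != 0 -> m != n -> rp_edge m n.
Proof.
have [f fF fh] := hat_support x y z => hm hn mn.
by apply/andP; split => //; apply/hasP; exists f; rewrite ?fh.
Qed.

Lemma hat_eq0 x y z m n : m != n -> ~~ rp_edge m n -> hat x y z m = hat x y z n ->
  hat x y z m = 0 /\ hat x y z n = 0.
Proof.
move=> mn nmn e; rewrite -e; suff -> : hat x y z m = 0 by [].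
by apply/eqP; apply: contraNT nmn => hm; apply: (hat_edge hm _ mn); rewrite -e.
Qed.

(** The flip exchanges non-adjacent vertices, whose equal coordinates must vanish. What remains of
    the formula for the absolute value of [x] is the coordinate at (1, 0, 0), which leaves only
    points that the flip fixes or sends to their antipode. *)
Lemma hat_flipx_fix x y z : (forall n, hat x y z n = hat x y z (flipx n)) ->
  x = 0 \/ (y = 0 /\ z = 0).
Proof.
move=> e; have [h5 h6] := hat_eq0 (m := 5) (n := 6) isT isT (e 5%N).
have [h7 h9] := hat_eq0 (m := 7) (n := 9) isT isT (e 7%N).
have [h8 h10] := hat_eq0 (m := 8) (n := 10) isT isT (e 8%N).
have := hat_normx x y z; rewrite h5 h6 h7 h8 h9 h10 !addr0 /hat /=.
have [->|x0] := eqVneq x 0; first by left.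
have [xm|xm] := leP 0 (`|x| - Num.max `|y| `|z|); last first.
  by rewrite rpos0 ?ltW// => /eqP; rewrite normr_eq0 (negPf x0).
rewrite rposE// => e1; right.
have : Num.max `|y| `|z| <= 0 by lra.
by rewrite ge_max !normr_le0 => /andP[/eqP -> /eqP ->].
Qed.

Lemma hat_flipz_fix x y z : (forall n, hat x y z n = hat x y z (flipz n)) ->
  z = 0 \/ (x = 0 /\ y = 0).
Proof.
move=> e; have [h3 h4] := hat_eq0 (m := 3) (n := 4) isT isT (e 3%N).
have [h7 h8] := hat_eq0 (m := 7) (n := 8) isT isT (e 7%N).
have [h9 h10] := hat_eq0 (m := 9) (n := 10) isT isT (e 9%N).
have := hat_normz x y z; rewrite h3 h4 h7 h8 h9 h10 !addr0 /hat /=.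
have [->|z0] := eqVneq z 0; first by left.
have [zm|zm] := leP 0 (`|z| - Num.max `|x| `|y|); last first.
  by rewrite rpos0 ?ltW// => /eqP; rewrite normr_eq0 (negPf z0).
rewrite rposE// => e1; right.
have : Num.max `|x| `|y| <= 0 by lra.
by rewrite ge_max !normr_le0 => /andP[/eqP -> /eqP ->].
Qed.

Lemma hat_flipxz_fix x y z : (forall n, hat x y z n = hat x y z (flipx (flipz n))) ->
  y = 0 \/ (x = 0 /\ z = 0).
Proof.
move=> e; have [h3 h4] := hat_eq0 (m := 3) (n := 4) isT isT (e 3%N).
have [h5 h6] := hat_eq0 (m := 5) (n := 6) isT isT (e 5%N).
(* Vertices 7 and 10 are adjacent, so they need not vanish, but only their difference enters
   [hat_normy]. *)
have h7 : hat x y z 7 = hat x y z 10 := e 7%N.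
have h8 : hat x y z 8 = hat x y z 9 := e 8%N.
have := hat_normy x y z; rewrite h3 h4 h5 h6 h7 h8 !subrr normr0 !addr0 /hat /=.
have [->|y0] := eqVneq y 0; first by left.
have [ym|ym] := leP 0 (`|y| - (`|x| + `|z|)); last first.
  by rewrite rpos0 ?ltW// => /eqP; rewrite normr_eq0 (negPf y0).
rewrite rposE// => e1; right.
have : `|x| + `|z| == 0 by apply/eqP; lra.
by rewrite paddr_eq0// !normr_eq0 => /andP[/eqP -> /eqP ->].
Qed.

(** The absolute values are recovered from the coordinates, so the points differ by a sign change.
    Up to the antipodal map it is a single flip, and the three preceding lemmas apply. *)
Lemma hat_inj x y z x' y' z' : hat x y z =1 hat x' y' z' ->
  [/\ x' = x, y' = y & z' = z] \/ [/\ x' = - x, y' = - y & z' = - z].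
Proof.
move=> e.
have : `|x'| == `|x| by rewrite (hat_normx x y z) (hat_normx x' y' z') !e.
have : `|y'| == `|y| by rewrite (hat_normy x y z) (hat_normy x' y' z') !e.
have : `|z'| == `|z| by rewrite (hat_normz x y z) (hat_normz x' y' z') !e.
rewrite !eqr_norm2 => /orP[]/eqP ez /orP[]/eqP ey /orP[]/eqP ex;
  move: e; rewrite ex ey ez => e.
- by left.
- have [||[-> ->]] := hat_flipx_fix (x := x) (y := y) (z := z).
  + by move=> n; rewrite e hat_flipx.
  + by move=> ->; left; rewrite oppr0.
  + by right; rewrite oppr0.
- have [||[-> ->]] := hat_flipxz_fix (x := x) (y := y) (z := z).
  + by move=> n; rewrite e -hat_even opprK hat_flipz hat_flipx.
  + by move=> ->; left; rewrite oppr0.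
  + by right; rewrite oppr0.
- have [||[-> ->]] := hat_flipz_fix (x := x) (y := y) (z := z).
  + by move=> n; rewrite e -hat_even !opprK hat_flipz.
  + by move=> ->; right; rewrite oppr0.
  + by left; rewrite oppr0.
- have [||[-> ->]] := hat_flipz_fix (x := x) (y := y) (z := z).
  + by move=> n; rewrite e hat_flipz.
  + by move=> ->; left; rewrite oppr0.
  + by right; rewrite oppr0.
- have [||[-> ->]] := hat_flipxz_fix (x := x) (y := y) (z := z).
  + by move=> n; rewrite e hat_flipz hat_flipx.
  + by move=> ->; right; rewrite oppr0.
  + by left; rewrite oppr0.
- have [||[-> ->]] := hat_flipx_fix (x := x) (y := y) (z := z).
  + by move=> n; rewrite e -hat_even !opprK hat_flipx.
  + by move=> ->; right; rewrite oppr0.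
  + by left; rewrite oppr0.
- by right.
Qed.

Definition realizable (f : seq nat) : Prop := forall h : nat -> R,
  (forall n, 0 <= h n) -> (forall n, n \notin f -> h n = 0) ->
  exists x y z, hat x y z =1 h.

Lemma realizable_flipx f f' : all (fun n => flipx n \in f) f' ->
  realizable f -> realizable f'.
Proof.
move=> /allP ff' rf h h0 hf'.
have [n|n nf|x [y [z e]]] := rf (h \o flipx); first exact: h0.
  by apply: hf' => /=; apply: contra nf => /ff'; rewrite flipxK.
by exists (- x), y, z => n; rewrite hat_flipx e /= flipxK.
Qed.

Lemma realizable_flipz f f' : all (fun n => flipz n \in f) f' ->
  realizable f -> realizable f'.
Proof.
move=> /allP ff' rf h h0 hf'.
have [n|n nf|x [y [z e]]] := rf (h \o flipz); first exact: h0.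
  by apply: hf' => /=; apply: contra nf => /ff'; rewrite flipzK.
by exists x, y, (- z) => n; rewrite hat_flipz e /= flipzK.
Qed.

Lemma tri_support p q r (h : nat -> R) : uniq [:: p; q; r] ->
  (forall n, n \notin [:: p; q; r] -> h n = 0) -> h =1 tri p q r (h p) (h q) (h r).
Proof.
rewrite /= !inE negb_or andbT => /andP[/andP[pq pr] qr] h0 n; rewrite /tri.
have [->|np] := eqVneq n p; first by rewrite (negPf pq) (negPf pr) !mulr0 !addr0 mulr1.
have [->|nq] := eqVneq n q; first by rewrite (negPf qr) !mulr0 !addr0 add0r mulr1.
have [->|nr] := eqVneq n r; first by rewrite !mulr0 !add0r mulr1.
by rewrite h0 ?inE ?negb_or ?np ?nq ?nr// !mulr0 !addr0.
Qed.

Lemma hat_flipy x y z n : hat x (- y) z n = hat x y z (flipx (flipz n)).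
Proof. by rewrite -hat_even opprK hat_flipz hat_flipx. Qed.

Lemma tri_flipy p a b c n : (p == 0%N) || (p == 1%N) ->
  tri p 7 10 a c b (flipx (flipz n)) = tri p 7 10 a b c n.
Proof.
move=> /orP[]/eqP ->; elim/nat11P: n => [|||||||||||n];
  by rewrite /tri /= /flipx /flipz ?nth_default//=; ring.
Qed.

Lemma realizable1 : realizable [:: 0; 3; 7]%N.
Proof.
move=> h h0 /tri_support e; do 3!eexists; move=> n; rewrite e//.
by apply: (@hat_cone1 R (h 0%N) (h 3%N) (h 7%N)).
Qed.

Lemma realizable2 : realizable [:: 0; 7; 10]%N.
Proof.
move=> h h0 /tri_support e.
have [h710|/ltW h107] := leP (h 10%N) (h 7%N).
  do 3!eexists; move=> n; rewrite e//.
  by apply: (@hat_cone2 R (h 0%N) (h 7%N) (h 10%N)).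
(* The half of the cone with [y < 0]: the reflection of [y] exchanges the rays 7 and 10. *)
exists (h 10%N + h 7%N), (- (h 10%N - h 7%N)), (h 0%N + h 10%N + h 7%N) => n.
by rewrite [RHS]e// hat_flipy hat_cone2// tri_flipy.
Qed.

Lemma realizable3 : realizable [:: 3; 7; 5]%N.
Proof.
move=> h h0 /tri_support e; do 3!eexists; move=> n; rewrite e//.
by apply: (@hat_cone3 R (h 3%N) (h 7%N) (h 5%N)).
Qed.

Lemma realizable4 : realizable [:: 3; 5; 2]%N.
Proof.
move=> h h0 /tri_support e; do 3!eexists; move=> n; rewrite e//.
by apply: (@hat_cone4 R (h 3%N) (h 5%N) (h 2%N)).
Qed.

Lemma realizable5 : realizable [:: 7; 5; 1]%N.
Proof.
move=> h h0 /tri_support e; do 3!eexists; move=> n; rewrite e//.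
by apply: (@hat_cone5 R (h 7%N) (h 5%N) (h 1%N)).
Qed.

Lemma realizable6 : realizable [:: 7; 10; 1]%N.
Proof.
move=> h h0 /tri_support e.
have [h710|/ltW h107] := leP (h 10%N) (h 7%N).
  do 3!eexists; move=> n; rewrite e//.
  by apply: (@hat_cone6 R (h 7%N) (h 10%N) (h 1%N)).
exists (h 10%N + h 7%N + h 1%N), (- (h 10%N - h 7%N)), (h 10%N + h 7%N) => n.
rewrite [RHS]e// hat_flipy hat_cone6//.
have rot p q r a b c m : tri p q r a b c m = tri r p q c a b m by rewrite /tri; ring.
by rewrite [LHS]rot [RHS]rot tri_flipy.
Qed.

Definition rp_base : seq (seq nat) :=
  [:: [:: 0; 3; 7]; [:: 0; 7; 10]; [:: 3; 7; 5]; [:: 3; 5; 2]; [:: 7; 5; 1];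
      [:: 7; 10; 1]]%N.

Lemma rp_facets_base : all (fun f : seq nat => has (fun b : seq nat =>
    [|| all (fun n => n \in b) f, all (fun n => flipx n \in b) f,
        all (fun n => flipz n \in b) f | all (fun n => flipx (flipz n) \in b) f])
  rp_base) rp_facets.
Proof. by vm_compute. Qed.

Lemma rp_facets_realizable f : f \in rp_facets -> realizable f.
Proof.
move=> /(allP rp_facets_base)/hasP[b bB].
have rb : realizable b.
  move: bB; rewrite !inE => /or4P[/eqP->|/eqP->|/eqP->|/or3P[/eqP->|/eqP->|/eqP->]].
  - exact: realizable1.
  - exact: realizable2.
  - exact: realizable3.
  - exact: realizable4.
  - exact: realizable5.
  - exact: realizable6.
case/or4P => [fb|fb|fb|fb].
- move=> h h0 hf; apply: rb => // n nb; apply: hf; apply: contra nb.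
  exact: (allP fb).
- exact: realizable_flipx fb rb.
- exact: realizable_flipz fb rb.
- apply: (@realizable_flipz (map flipz f)).
    by apply/allP => n nf; exact: map_f.
  by apply: realizable_flipx rb; rewrite all_map.
Qed.

End rp_fan.

(** * From the sphere to the complex on 11 vertices *)

Section projective_plane_triangulation.
Variable R : realType.
Implicit Types (s t : sphere R 2).

Let i0 : 'I_3 := @Ordinal 3 0 isT.
Let i1 : 'I_3 := @Ordinal 3 1 isT.
Let i2 : 'I_3 := @Ordinal 3 2 isT.

Definition sx s : R := val s ord0 i0.
Definition sy s : R := val s ord0 i1.
Definition sz s : R := val s ord0 i2.

Lemma ord3_ind (P : 'I_3 -> Prop) : P i0 -> P i1 -> P i2 -> forall i, P i.
Proof.
by move=> P0 P1 P2 [[|[|[|//]]] Hm]; rewrite (bool_irrelevance Hm isT).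
Qed.

Lemma sqnorm3 (v : 'rV[R]_3) :
  sqnorm v = v ord0 i0 ^+ 2 + v ord0 i1 ^+ 2 + v ord0 i2 ^+ 2.
Proof.
rewrite /sqnorm !big_ord_recl big_ord0 addr0 addrA.
by congr (v _ _ ^+ 2 + v _ _ ^+ 2 + v _ _ ^+ 2); apply: val_inj.
Qed.

Lemma sphere_eq s : sx s ^+ 2 + sy s ^+ 2 + sz s ^+ 2 = 1.
Proof. by rewrite -sqnorm3; exact: (set_valP s). Qed.

Lemma sphere_coord_continuous (j : 'I_3) :
  continuous (fun s : sphere R 2 => val s ord0 j).
Proof.
move=> d; apply: (@continuous_comp _ _ _ (val : sphere R 2 -> 'rV[R]_3)
  (fun f : 'rV[R]_3 => f ord0 j)).
  exact: val_continuous.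
exact: coord_continuous.
Qed.

Lemma antipodalP s t : antipodal s t <->
  [/\ sx t = sx s, sy t = sy s & sz t = sz s] \/
  [/\ sx t = - sx s, sy t = - sy s & sz t = - sz s].
Proof.
split=> [/orP[/eqP e|/eqP e]|[[ex ey ez]|[ex ey ez]]].
- by left; rewrite /sx /sy /sz e.
- by right; rewrite /sx /sy /sz e !mxE !opprK.
- apply/orP; left; apply/eqP/rowP; apply: ord3_ind; exact/esym.
- by apply/orP; right; apply/eqP/rowP; apply: ord3_ind; rewrite mxE;
    rewrite -?[val t _ i0]/(sx t) -?[val t _ i1]/(sy t) -?[val t _ i2]/(sz t)
      ?ex ?ey ?ez opprK.
Qed.

Definition hat_sum s : R := \sum_(v < 11) hat (sx s) (sy s) (sz s) v.

Lemma hat_sum_gt0 s : 0 < hat_sum s.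
Proof.
have h0 n := hat_ge0 (sx s) (sy s) (sz s) n.
rewrite lt_neqAle eq_sym; apply/andP; split; last by apply: sumr_ge0 => i _.
rewrite psumr_eq0 => [|i _]; last exact: h0.
apply/negP => /allP hz.
have z n : hat (sx s) (sy s) (sz s) n = 0.
  have [n11|n11] := ltnP n 11; last by rewrite -(subnKC n11) hat_big.
  by have := hz (Ordinal n11); rewrite mem_index_enum => /(_ isT)/eqP.
have := sphere_eq s.
have -> : sx s = 0 by apply/eqP; rewrite -normr_eq0 (hat_normx _ (sy s) (sz s)) !z !addr0.
have -> : sz s = 0 by apply/eqP; rewrite -normr_eq0 (hat_normz (sx s) (sy s)) !z !addr0.
have -> : sy s = 0.
  by apply/eqP; rewrite -normr_eq0 (hat_normy (sx s) _ (sz s)) !z subrr normr0 !addr0.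
by rewrite expr0n /= !addr0 => /eqP; rewrite eq_sym oner_eq0.
Qed.

Definition rp_coord s (v : 'I_11) : R := hat (sx s) (sy s) (sz s) v / hat_sum s.

Lemma rp_coord_barycentric s : barycentric rp_adj (rp_coord s).
Proof.
have S0 := hat_sum_gt0 s; split.
- by move=> v; rewrite divr_ge0 ?hat_ge0// ltW.
- by rewrite -big_distrl /= divff// gt_eqF.
- move=> u v; rewrite !mulf_eq0 !negb_or => /andP[hu _] /andP[hv _] uv.
  exact: hat_edge hu hv uv.
Qed.

Definition rp_map s : realization R (clique_complex rp_adj) :=
  bary_point (rp_coord_barycentric s).

Lemma sphere_ray (x y z x' y' z' c : R) : 0 < c ->
  x ^+ 2 + y ^+ 2 + z ^+ 2 = 1 -> x' ^+ 2 + y' ^+ 2 + z' ^+ 2 = 1 ->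
  x' ^+ 2 = (c * x) ^+ 2 -> y' ^+ 2 = (c * y) ^+ 2 -> z' ^+ 2 = (c * z) ^+ 2 -> c = 1.
Proof.
move=> c0 n1 n1' ex ey ez.
have c2 : c ^+ 2 = 1 by rewrite -[LHS]mulr1 -[X in _ * X]n1 -n1' ex ey ez; ring.
move/eqP: c2; rewrite sqrf_eq1 => /orP[/eqP//|/eqP c1]; lra.
Qed.

Lemma rp_map_kernel s t : rp_map s = rp_map t <-> antipodal s t.
Proof.
have S0 := hat_sum_gt0 s; have T0 := hat_sum_gt0 t.
split=> [e|/antipodalP st]; last first.
  have h n : hat (sx t) (sy t) (sz t) n = hat (sx s) (sy s) (sz s) n.
    by case: st => -[-> -> ->]; rewrite ?hat_even.
  apply: bary_inj => v; rewrite !bary_pointK /rp_coord /hat_sum h.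
  by congr (_ / _); apply: eq_bigr => i _; rewrite h.
(* By homogeneity, equal normalized coordinates mean that [c] times [s] and [t] have the same [hat]
   values; unit length then forces [c = 1]. *)
pose c := hat_sum t / hat_sum s; have c0 : 0 < c by rewrite divr_gt0.
have h : hat (c * sx s) (c * sy s) (c * sz s) =1 hat (sx t) (sy t) (sz t).
  move=> n; rewrite hatZ ?(ltW c0)//.
  have [n11|n11] := ltnP n 11; last by rewrite -(subnKC n11) !hat_big mulr0.
  have := congr1 (fun x => bary x (Ordinal n11)) e.
  rewrite !bary_pointK /rp_coord /= => /(canRL (divfK (lt0r_neq0 S0))) ->.
  by rewrite /c; field; rewrite !lt0r_neq0.
have c1 : c = 1.
  apply: (sphere_ray c0 (sphere_eq s) (sphere_eq t));
  by have [[ex ey ez]|[ex ey ez]] := hat_inj h; rewrite ?ex ?ey ?ez ?sqrrN.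
by apply/antipodalP; move: (hat_inj h); rewrite c1 !mul1r.
Qed.

Lemma sphere_pointP (x y z : R) : x ^+ 2 + y ^+ 2 + z ^+ 2 = 1 ->
  exists s, [/\ sx s = x, sy s = y & sz s = z].
Proof.
move=> e; pose v : 'rV[R]_3 := \row_j nth 0 [:: x; y; z] j.
have vs : @unit_sphere R 2 v by rewrite /unit_sphere /= sqnorm3 !mxE.
by exists (SigSub (mem_set vs)); rewrite /sx /sy /sz !SubK !mxE.
Qed.

(** The support is a clique, hence inside a listed triangle, and the cone over that triangle
    contains a vector with these coordinates; it is then rescaled to unit length. *)
Lemma rp_map_surj x : exists s, rp_map s = x.
Proof.
have [z0 z1 zK] := baryP x.
pose h n : R := if insub n is Some v then bary x v else 0.
have hv (v : 'I_11) : h v = bary x v by rewrite /h valK.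
have h0 n : 0 <= h n by rewrite /h; case: insub.
have [|f fF hf] := @rp_clique_covered (fun n => h n != 0).
  move=> m n m11 n11; rewrite -[m]/(val (Ordinal m11)) -[n]/(val (Ordinal n11)) !hv.
  exact: zK.
have [//|n nf|p [q [r e]]] := rp_facets_realizable fF (h := h).
  apply/eqP; apply: contraNT nf => hn; apply: hf => //.
  by rewrite ltnNge; apply: contra hn => n11; rewrite /h insubF// ltnNge n11.
pose N := p ^+ 2 + q ^+ 2 + r ^+ 2.
have N0 : 0 <= N by rewrite !addr_ge0 ?sqr_ge0.
have N1 : N != 0.
  apply/eqP => /eqP; rewrite !paddr_eq0 ?addr_ge0 ?sqr_ge0// !sqrf_eq0.
  move=> /andP[/andP[/eqP p0 /eqP q0] /eqP r0].
  have : \sum_v bary x v = 0.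
    apply: big1 => v _; rewrite -hv -e p0 q0 r0.
    by have := hatZ 0 0 0 v (lexx (0 : R)); rewrite !mul0r.
  by rewrite z1 => /eqP; rewrite oner_eq0.
pose c := Num.sqrt N.
have c0 : 0 < c by rewrite sqrtr_gt0 lt_neqAle eq_sym N1.
have cn := lt0r_neq0 c0.
have [|s [es1 es2 es3]] := @sphere_pointP (c^-1 * p) (c^-1 * q) (c^-1 * r).
  by rewrite !exprMn -!mulrDr exprVn sqr_sqrtr// mulVf.
have hs n : hat (sx s) (sy s) (sz s) n = c^-1 * h n.
  by rewrite es1 es2 es3 hatZ ?invr_ge0 ?ltW// e.
have S1 : hat_sum s = c^-1.
  rewrite /hat_sum (eq_bigr (fun v : 'I_11 => c^-1 * bary x v)) => [|v _]; last by rewrite hs hv.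
  by rewrite -big_distrr /= z1 mulr1.
exists s; apply: bary_inj => v; rewrite bary_pointK /rp_coord hs hv S1.
by field.
Qed.

Lemma quint_continuous (T : topologicalType) (f g h : T -> R) :
  continuous f -> continuous g -> continuous h ->
  continuous (fun u => quint (f u) (g u) (h u)).
Proof.
move=> fc gc hc; apply: rpos_continuous.
have fgc : continuous (fun u => (f u + g u) / 2).
  by apply: contM; [exact: contD|exact: cont_cst].
have hgc : continuous (fun u => (h u + g u) / 2).
  by apply: contM; [exact: contD|exact: cont_cst].
have fghc : continuous (fun u => f u - g u + h u) by apply: contD => //; exact: contB.
by do 4!apply: cont_min => //.
Qed.

Lemma hat_continuous (T : topologicalType) (f g h : T -> R) n :
  continuous f -> continuous g -> continuous h ->
  continuous (fun u => hat (f u) (g u) (h u) n).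
Proof.
move=> fc gc hc.
have fN := contN fc; have gN := contN gc; have hN := contN hc.
have fa := cont_norm fc; have ga := cont_norm gc; have ha := cont_norm hc.
elim/nat11P: n => [|||||||||||n]; rewrite /hat /=.
- by apply: rpos_continuous; apply: contB => //; exact: cont_max.
- by apply: rpos_continuous; apply: contB => //; exact: cont_max.
- by apply: rpos_continuous; apply: contB => //; exact: contD.
- by apply: contD; apply: posmin_continuous => //; exact: contB.
- by apply: contD; apply: posmin_continuous => //; exact: contB.
- by apply: contD; apply: posmin_continuous => //; exact: contB.
- by apply: contD; apply: posmin_continuous => //; exact: contB.
- by apply: contD; exact: quint_continuous.
- by apply: contD; exact: quint_continuous.
- by apply: contD; exact: quint_continuous.
- by apply: contD; exact: quint_continuous.
- exact: cont_cst.
Qed.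

Lemma rp_map_continuous : continuous rp_map.
Proof.
have hc n : continuous (fun s => hat (sx s) (sy s) (sz s) n).
  by apply: hat_continuous; exact: sphere_coord_continuous.
apply: to_realization_continuous => v; apply: cont_div => //.
- by move=> s; rewrite gt_eqF// hat_sum_gt0.
- by apply: cont_sum => i; exact: hc.
Qed.

Lemma projective_plane_homeomorphic :
  homeomorphic (realization R (clique_complex rp_adj)) (projective_plane R).
Proof.
apply: (@homeomorphic_of_quotient_maps (sphere R 2) _ _ rp_map).
- apply: compact_hausdorff_quotient_map.
  + exact: rp_map_continuous.
  + exact: rp_map_surj.
  + exact: sphere_compact.
  + exact: realization_hausdorff.
- exact: pi_quotient_map.
- by move=> s t; rewrite rp_map_kernel; split=> [st|/eqmodP//]; apply/eqmodP.
Qed.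

Lemma projective_plane_summand : exists (c d : 'I_6 -> 'I_11),
  summand R (projective_plane R) rp_adj (o11 0) (o11 1) c d.
Proof.
do 2!eexists; split.
- exact: rp_star0.
- exact: rp_star1.
- by [].
- exact: compact_surj rp_map_continuous rp_map_surj (@sphere_compact R 2).
- exact: projective_plane_homeomorphic.
Qed.

End projective_plane_triangulation.

Theorem theorem4p11 (R : realType) (k : nat) (hk : (1 <= k)%N) :
  ((exists (V : finType) (K : {set {set V}}),
      is_flag_triangulation R (is_iterated_connected_sum R (torus R) k) K
      /\ (#|V| <= 8 + 4 * k)%N)
   /\
   (exists (V : finType) (K : {set {set V}}),
      is_flag_triangulation R
        (is_iterated_connected_sum R (projective_plane R) k) K
      /\ (#|V| <= 8 + 3 * k)%N))
  /\
  ((forall (V : finType) (K : {set {set V}}),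
      is_vertex_minimal_flag_triangulation R
        (is_iterated_connected_sum R (torus R) k) K ->
      (#|V| <= 8 + 4 * k)%N)
   /\
   (forall (V : finType) (K : {set {set V}}),
      is_vertex_minimal_flag_triangulation R
        (is_iterated_connected_sum R (projective_plane R) k) K ->
      (#|V| <= 8 + 3 * k)%N)).
Proof.
have [ct [dt /summand_bounds/(_ torus_card hk) [Te Tm]]] := torus_summand R.
have [cp [dp /summand_bounds/(_ (card_ord 11) hk) [Pe Pm]]] := projective_plane_summand R.
by split.
Qed.
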